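(* Let $(R,\mathfrak m)$ be a $d$-dimensional Cohen--Macaulay complete local ring and let $\mathcal F$ be an additive functor from $R$-modules to $R$-modules which is a direct summand (as a functor) of the local cohomology functor $H^d_{\mathfrak m}(-)$ and which preserves direct sums. Then $\mathcal F$ is trivial, that is, either $\mathcal F=0$ or $\mathcal F\cong H^d_{\mathfrak m}(-)$.
   Context: Rings are commutative and noetherian; complete means complete in the $\mathfrak m$-adic topology. $H^d_{\mathfrak m}(-)$ is the $d$-th right derived functor of the $\mathfrak m$-torsion functor on the category of all $R$-modules. $\mathcal F$ is a direct summand of $H^d_{\mathfrak m}(-)$ if there is a functor $\mathcal G$ with $H^d_{\mathfrak m}(-)\cong\mathcal F\oplus\mathcal G$ naturally. *)

(* Defs.v *)
From HB Require Import structures.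
From mathcomp Require Import all_boot all_order all_algebra.
From mathcomp Require Import boolp classical_sets functions.

Set Implicit Arguments.
Unset Strict Implicit.
Unset Printing Implicit Defensive.

Import Order.TTheory GRing.Theory Num.Theory.
Local Open Scope classical_set_scope.
Local Open Scope ring_scope.

Definition is_submodule (R : comNzRingType) (M : lmodType R) (N : set M) : Prop :=
  [/\ N 0, (forall x y, N x -> N y -> N (x + y)) &
      (forall (a : R) x, N x -> N (a *: x))].

Record submodule (R : comNzRingType) (M : lmodType R) := Submodule {
  submodule_set :> M -> Prop;
  submoduleP : is_submodule submodule_set }.

Definition mk_linear (R : comNzRingType) (M N : lmodType R) (f : M -> N)
    (f_lin : linear f) : {linear M -> N} :=
  HB.pack f (GRing.isLinear.Build R M N *:%R f f_lin).

Section SubQuotient.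
Variables (R : comNzRingType) (M : lmodType R) (N : submodule M).

Definition mem_submodule : M -> bool := fun x => `[< N x >].

Lemma mem_submodule_closed : subsemimod_closed mem_submodule.
Proof.
have [N0 ND NZ] := submoduleP N.
split; first split; first exact/asboolP.
- by move=> x y /asboolP Nx /asboolP Ny; apply/asboolP/ND.
- by move=> a x /asboolP Nx; apply/asboolP/NZ.
Qed.

HB.instance Definition _ :=
  GRing.isSubmodClosed.Build R M mem_submodule mem_submodule_closed.

Definition submod_type : Type := {x : M | mem_submodule x}.

HB.instance Definition _ := SubChoice.on submod_type.
HB.instance Definition _ :=
  GRing.SubChoice_isSubLmodule.Build R M mem_submodule submod_type
    mem_submodule_closed.

Definition submod_elt (x : M) (Nx : N x) : submod_type :=
  exist (fun x => mem_submodule x) x (asboolT Nx).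

Lemma submod_valP (x : submod_type) : N (val x).
Proof. exact/asboolP/(valP x). Qed.

Definition mem_submodule_zmod : zmodClosed M :=
  Algebra.ZmodClosed.clone M mem_submodule _.

Definition quot_type : Type := Quotient.quot mem_submodule_zmod.

HB.instance Definition _ := GRing.Zmodule.on quot_type.

Definition quot_proj (x : M) : quot_type := (\pi_(quot_type) x)%qT.
Definition quot_repr (q : quot_type) : M := repr q.

Lemma quot_reprK q : quot_proj (quot_repr q) = q.
Proof. exact: reprK. Qed.

Lemma quot_projP x y : quot_proj x = quot_proj y <-> N (x - y).
Proof.
rewrite /quot_proj; split.
  move=> /eqP xy; apply/asboolP.
  have := Quotient.idealrBE mem_submodule_zmod x y.
  by rewrite xy.
move=> /asboolP Nxy; apply/eqP.
by rewrite -(Quotient.idealrBE mem_submodule_zmod x y).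
Qed.

Lemma quot_reprP x : N (quot_repr (quot_proj x) - x).
Proof. by apply/quot_projP; rewrite quot_reprK. Qed.

Lemma quot_projD x y : quot_proj (x + y) = quot_proj x + quot_proj y.
Proof. exact: raddfD. Qed.

Definition quot_scale (a : R) (q : quot_type) : quot_type :=
  quot_proj (a *: quot_repr q).

Lemma quot_scaleE a x : quot_scale a (quot_proj x) = quot_proj (a *: x).
Proof.
apply/quot_projP; rewrite -scalerBr.
by have [_ _ NZ] := submoduleP N; apply: NZ; exact: quot_reprP.
Qed.

Lemma quot_scalerA a b q : quot_scale a (quot_scale b q) = quot_scale (a * b) q.
Proof. by rewrite -[q]quot_reprK !quot_scaleE scalerA. Qed.

Lemma quot_scale1r : left_id 1 quot_scale.
Proof. by move=> q; rewrite -[q]quot_reprK quot_scaleE scale1r. Qed.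

Lemma quot_scalerDr : right_distributive quot_scale +%R.
Proof.
move=> a p q; rewrite -[p]quot_reprK -[q]quot_reprK.
by rewrite -quot_projD !quot_scaleE scalerDr quot_projD.
Qed.

Lemma quot_scalerDl q : {morph quot_scale^~ q : a b / a + b}.
Proof.
by move=> a b; rewrite -[q]quot_reprK !quot_scaleE scalerDl quot_projD.
Qed.

HB.instance Definition _ := GRing.Zmodule_isLmodule.Build R quot_type
  quot_scalerA quot_scale1r quot_scalerDr quot_scalerDl.

Lemma quot_proj_is_linear : linear quot_proj.
Proof. by move=> a x y; rewrite quot_projD -quot_scaleE. Qed.

HB.instance Definition _ :=
  GRing.isLinear.Build R M quot_type *:%R quot_proj quot_proj_is_linear.

End SubQuotient.

Section QuotLift.
Variables (R : comNzRingType) (M P : lmodType R) (N : submodule M).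
Variables (f : {linear M -> P}) (fN : forall x, N x -> f x = 0).

Lemma quot_lift_subproof :
  exists g : {linear quot_type N -> P}, forall x, g (quot_proj N x) = f x.
Proof.
have fE x : f (quot_repr (quot_proj N x)) = f x.
  by apply/eqP; rewrite -subr_eq0 -linearB; apply/eqP/fN/quot_reprP.
have lin : linear (fun q : quot_type N => f (quot_repr q)).
  move=> a p q; rewrite -[p]quot_reprK -[q]quot_reprK.
  by rewrite -linearP !fE linearP.
by exists (mk_linear lin) => x; exact: fE.
Qed.

End QuotLift.

Section Kernels.
Variables (R : comNzRingType) (M N : lmodType R) (f : {linear M -> N}).

Lemma ker_is_submodule : is_submodule [set x | f x = 0].
Proof.
split=> [|x y /= fx fy|a x /= fx]; first exact: linear0.
- by rewrite linearD fx fy addr0.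
- by rewrite linearZ_LR fx scaler0.
Qed.

Definition ker_submodule : submodule M := Submodule ker_is_submodule.

Lemma im_is_submodule : is_submodule (range f).
Proof.
split=> [|_ _ [x _ <-] [y _ <-]|a _ [x _ <-]].
- by exists 0; rewrite ?linear0.
- by exists (x + y); rewrite ?linearD.
- by exists (a *: x); rewrite ?linearZ_LR.
Qed.

Definition im_submodule : submodule N := Submodule im_is_submodule.

End Kernels.

Lemma zero_is_submodule (R : comNzRingType) (M : lmodType R) :
  is_submodule [set (0 : M)].
Proof.
by split=> [//|x y /= -> ->|a x /= ->]; rewrite ?addr0 ?scaler0.
Qed.

Definition zero_submodule (R : comNzRingType) (M : lmodType R) : submodule M :=
  Submodule (zero_is_submodule M).

Section SubQ.
Variables (R : comNzRingType) (M : lmodType R) (Z B : submodule M).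

Lemma traced_is_submodule : is_submodule [set x : submod_type Z | B (val x)].
Proof.
have [B0 BD BZ] := submoduleP B; split => //=.
- by move=> x y Bx By; exact: BD.
- by move=> a x Bx; exact: BZ.
Qed.

Definition traced_submodule : submodule (submod_type Z) :=
  Submodule traced_is_submodule.

(* Z / (B :&: Z); in the sequel B is contained in Z *)
Definition subquotient : lmodType R := quot_type traced_submodule.

Definition subq_proj (x : M) (Zx : Z x) : subquotient :=
  quot_proj traced_submodule (submod_elt Zx).

Lemma subq_projP x y (Zx : Z x) (Zy : Z y) :
  subq_proj Zx = subq_proj Zy <-> B (x - y).
Proof. exact: quot_projP. Qed.

Lemma subq_proj_surj (q : subquotient) :
  exists x (Zx : Z x), q = subq_proj Zx.
Proof.
exists (val (quot_repr q)), (submod_valP (quot_repr q)).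
rewrite -[LHS]quot_reprK; congr quot_proj; exact/val_inj.
Qed.

End SubQ.

Section SubQMap.
Variables (R : comNzRingType) (M M' : lmodType R).
Variables (Z B : submodule M) (Z' B' : submodule M') (f : {linear M -> M'}).
Hypothesis fZ : forall x, Z x -> Z' (f x).
Hypothesis fB : forall x, B x -> B' (f x).

Definition subq_map_fun (q : subquotient Z B) : subquotient Z' B' :=
  subq_proj B' (fZ (submod_valP (quot_repr q))).

Lemma subq_map_funE x (Zx : Z x) :
  subq_map_fun (subq_proj B Zx) = subq_proj B' (fZ Zx).
Proof.
apply/subq_projP; rewrite -linearB; apply: fB.
exact: (quot_reprP (traced_submodule Z B)).
Qed.

Lemma subq_map_is_linear : linear subq_map_fun.
Proof.
move=> a p q.
have [x [Zx ->]] := subq_proj_surj p; have [y [Zy ->]] := subq_proj_surj q.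
have Zxy : Z (a *: x + y).
  by have [_ ZD ZZ] := submoduleP Z; apply: ZD => //; exact: ZZ.
have -> : a *: subq_proj B Zx + subq_proj B Zy = subq_proj B Zxy.
  rewrite /subq_proj -linearP; congr quot_proj; exact/val_inj.
rewrite !subq_map_funE /subq_proj -linearP; congr quot_proj; apply/val_inj => /=.
by rewrite linearP.
Qed.

Definition subq_map : {linear subquotient Z B -> subquotient Z' B'} :=
  mk_linear subq_map_is_linear.

Lemma subq_mapE x (Zx : Z x) : subq_map (subq_proj B Zx) = subq_proj B' (fZ Zx).
Proof. exact: subq_map_funE. Qed.

End SubQMap.

(* By [boolp] every type carries a choiceType structure, so [lmodType R] does
   not exclude any R-module *)
Record functor (R : comNzRingType) := Functor {
  fobj :> lmodType R -> lmodType R;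
  fmap : forall M N : lmodType R, {linear M -> N} -> {linear fobj M -> fobj N};
  fmap_ext : forall (M N : lmodType R) (f g : {linear M -> N}),
    f =1 g -> fmap f =1 fmap g;
  fmap_id : forall M : lmodType R, fmap (idfun : {linear M -> M}) =1 id;
  fmap_comp : forall (M N P : lmodType R) (f : {linear M -> N})
    (g : {linear N -> P}), fmap (g \o f) =1 fmap g \o fmap f }.

Definition additive_functor (R : comNzRingType) (F : functor R) : Prop :=
  forall (M N : lmodType R) (f g : {linear M -> N}),
    fmap F (f \+ g) =1 fmap F f \+ fmap F g.

Definition nat_iso (R : comNzRingType) (F G : functor R) : Prop :=
  exists eta : forall M : lmodType R, {linear F M -> G M},
    (forall (M N : lmodType R) (f : {linear M -> N}),
       eta N \o fmap F f =1 fmap G f \o eta M) /\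
    (forall M : lmodType R, bijective (eta M)).

Definition zero_functor (R : comNzRingType) (F : functor R) : Prop :=
  forall (M : lmodType R) (x : F M), x = 0.

Section FunctorSum.
Variables (R : comNzRingType) (F G : functor R).

Definition sum_fmap_fun (M N : lmodType R) (f : {linear M -> N})
    (p : (F M * G M)%type) : (F N * G N)%type :=
  (fmap F f p.1, fmap G f p.2).

Lemma sum_fmap_linear (M N : lmodType R) (f : {linear M -> N}) :
  linear (sum_fmap_fun f).
Proof. by move=> a p q; rewrite /sum_fmap_fun /= !linearP. Qed.

Definition functor_sum : functor R.
Proof.
refine (@Functor R (fun M => (F M * G M)%type)
  (fun M N f => mk_linear (sum_fmap_linear f)) _ _ _).
- by move=> M N f g fg [x y]; congr pair; exact: fmap_ext.
- by move=> M [x y]; congr pair; exact: fmap_id.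
- by move=> M N P f g [x y]; congr pair; exact: fmap_comp.
Defined.

End FunctorSum.

Definition direct_summand (R : comNzRingType) (F H : functor R) : Prop :=
  exists G : functor R, nat_iso H (functor_sum F G).

(* [S], with the maps [inj i], is the direct sum (i.e., the coproduct in the
   category of R-modules) of the [M i] *)
Definition is_direct_sum (R : comNzRingType) (I : Type) (M : I -> lmodType R)
    (S : lmodType R) (inj : forall i, {linear M i -> S}) : Prop :=
  forall (N : lmodType R) (g : forall i, {linear M i -> N}),
    exists2 h : {linear S -> N}, (forall i, h \o inj i =1 g i) &
      forall h' : {linear S -> N}, (forall i, h' \o inj i =1 g i) -> h' =1 h.

Definition preserves_direct_sums (R : comNzRingType) (F : functor R) : Prop :=
  forall (I : Type) (M : I -> lmodType R) (S : lmodType R)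
    (inj : forall i, {linear M i -> S}),
    is_direct_sum inj -> is_direct_sum (fun i => fmap F (inj i)).

Definition injective_module (R : comNzRingType) (E : lmodType R) : Prop :=
  forall (A B : lmodType R) (i : {linear A -> B}) (f : {linear A -> E}),
    injective i -> exists g : {linear B -> E}, g \o i =1 f.

(* 0 -> M -> I 0 -> I 1 -> I 2 -> ... *)
Record injective_resolution (R : comNzRingType) (M : lmodType R) := InjRes {
  ires_obj :> nat -> lmodType R;
  ires_aug : {linear M -> ires_obj 0%N};
  ires_d : forall n, {linear ires_obj n -> ires_obj n.+1};
  ires_injective : forall n, injective_module (ires_obj n);
  ires_aug_inj : injective ires_aug;
  ires_exact0 : forall x, ires_d 0%N x = 0 <-> exists y, ires_aug y = x;
  ires_exactS : forall n x, ires_d n.+1 x = 0 <-> exists y, ires_d n y = x }.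

Lemma extend_along (R : comNzRingType) (A B E : lmodType R)
    (u : {linear A -> B}) (f : {linear A -> E}) :
  injective_module E -> (forall x, u x = 0 -> f x = 0) ->
  exists g : {linear B -> E}, g \o u =1 f.
Proof.
move=> injE uf.
have [ub ubE] := @quot_lift_subproof _ _ _ (ker_submodule u) u (fun x => id).
have [fb fbE] := @quot_lift_subproof _ _ _ (ker_submodule u) f uf.
have [|g gE] := injE _ _ ub fb.
  move=> p q; rewrite -[p]quot_reprK -[q]quot_reprK !ubE => upq.
  by apply/quot_projP => /=; rewrite linearB upq subrr.
by exists g => x /=; rewrite -fbE -gE /= ubE.
Qed.

(* The augmented resolution M -> I 0 -> I 1 -> ..., with M in degree 0 *)
Definition aug_obj (R : comNzRingType) (M : lmodType R)
    (I : injective_resolution M) (n : nat) : lmodType R :=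
  if n is n'.+1 then I n' else M.

Definition aug_d (R : comNzRingType) (M : lmodType R)
    (I : injective_resolution M) (n : nat) :
    {linear aug_obj I n -> aug_obj I n.+1} :=
  if n is n'.+1 then ires_d I n' else ires_aug I.

Section Lifts.
Variables (R : comNzRingType) (M N : lmodType R).
Variables (I : injective_resolution M) (J : injective_resolution N).

Lemma aug_exact n x : aug_d I n.+1 x = 0 <-> exists y, aug_d I n y = x.
Proof. by case: n x => [|n] x; [exact: ires_exact0|exact: ires_exactS]. Qed.

Lemma aug_dd n x : aug_d I n.+1 (aug_d I n x) = 0.
Proof. by apply/aug_exact; exists x. Qed.

Definition lifts (f : {linear M -> N}) (phi : forall n, {linear I n -> J n}) : Prop :=
  (ires_aug J \o f =1 phi 0%N \o ires_aug I) /\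
  (forall n, ires_d J n \o phi n =1 phi n.+1 \o ires_d I n).

End Lifts.

Section LiftExistence.
Variables (R : comNzRingType) (M N : lmodType R).
Variables (I : injective_resolution M) (J : injective_resolution N).

Let sq n (p : {linear aug_obj I n -> aug_obj J n} *
              {linear aug_obj I n.+1 -> aug_obj J n.+1}) : Prop :=
  aug_d J n \o p.1 =1 p.2 \o aug_d I n.

Lemma lift_step n p : sq p -> exists q : {linear aug_obj I n.+2 -> aug_obj J n.+2},
  @sq n.+1 (p.2, q).
Proof.
move=> sqp.
have [|q qE] := @extend_along _ _ _ _ (aug_d I n.+1) (aug_d J n.+1 \o p.2)
    (@ires_injective _ _ J n.+1).
  move=> x /aug_exact[y <-] /=.
  by have /= <- := sqp y; rewrite aug_dd.
by exists q => x; rewrite qE.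
Qed.

Lemma lift0 (f : {linear M -> N}) :
  exists q : {linear aug_obj I 1 -> aug_obj J 1}, @sq 0 (f, q).
Proof.
have [|q qE] := @extend_along _ _ _ _ (aug_d I 0) (aug_d J 0 \o f)
    (@ires_injective _ _ J 0).
  move=> x x0; suff -> : x = 0 by rewrite linear0.
  by apply: (@ires_aug_inj _ _ I); rewrite linear0.
by exists q => x; rewrite qE.
Qed.

Fixpoint lift_seq (f : {linear M -> N}) n : {p | @sq n p} :=
  if n is n'.+1 then
    let: exist p sqp := lift_seq f n' in
    let: exist q sqq := cid (lift_step sqp) in
    exist _ (p.2, q) sqq
  else let: exist q sqq := cid (lift0 f) in exist _ ((f : {linear aug_obj I 0 -> aug_obj J 0}), q) sqq.

Lemma lift_exists (f : {linear M -> N}) : exists phi, @lifts _ _ _ I J f phi.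
Proof.
pose psi n := (sval (lift_seq f n)).1.
have psi0 : psi 0%N = f by rewrite /psi /=; case: cid.
have psiS n : aug_d J n \o psi n =1 psi n.+1 \o aug_d I n.
  rewrite /psi /=; case: (lift_seq f n) => p sqp /=; case: cid => q sqq /=.
  exact: sqp.
exists (fun n => psi n.+1); split=> [x|n x]; last exact: (psiS n.+1).
by have := psiS 0%N x; rewrite psi0.
Qed.

End LiftExistence.

Section Homotopy.
Variables (R : comNzRingType) (M N : lmodType R).
Variables (I : injective_resolution M) (J : injective_resolution N).
Variables (f : {linear M -> N}) (phi psi : forall n, {linear I n -> J n}).
Hypotheses (phiL : lifts f phi) (psiL : lifts f psi).

Let D n : {linear I n -> J n} := phi n \- psi n.

Let D_aug x : D 0%N (ires_aug I x) = 0.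
Proof.
by have /= := (phiL.1 x); rewrite /D/= => <-; have /= <- := (psiL.1 x); rewrite subrr.
Qed.

Let D_d n x : D n.+1 (ires_d I n x) = ires_d J n (D n x).
Proof.
have /= h1 := (phiL.2 n x); have /= h2 := (psiL.2 n x).
by rewrite /D /= -h1 -h2 linearB.
Qed.

Lemma homotopy0 : exists h : {linear I 1%N -> J 0%N}, h \o ires_d I 0 =1 D 0%N.
Proof.
apply: extend_along; first exact: ires_injective.
by move=> x /ires_exact0[y <-]; exact: D_aug.
Qed.

Lemma homotopy_step n (h : {linear I n.+1 -> J n}) :
  (forall x, ires_d J n (D n x - h (ires_d I n x)) = 0) ->
  exists h' : {linear I n.+2 -> J n.+1},
    forall x, D n.+1 x = ires_d J n (h x) + h' (ires_d I n.+1 x).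
Proof.
move=> hh.
have [|h' h'E] := @extend_along _ _ _ _ (ires_d I n.+1) (D n.+1 \- (ires_d J n \o h))
    (@ires_injective _ _ J n.+1).
  move=> x /ires_exactS[y <-].
  rewrite -[LHS]/(D n.+1 (ires_d I n y) - ires_d J n (h (ires_d I n y))).
  by rewrite D_d -linearB; exact: hh.
by exists h' => x; have /= -> := h'E x; rewrite [RHS]addrC subrK.
Qed.

Lemma homotopy n : exists (h : {linear I n.+1 -> J n}) (h' : {linear I n.+2 -> J n.+1}),
  forall x, D n.+1 x = ires_d J n (h x) + h' (ires_d I n.+1 x).
Proof.
elim: n => [|n [h [h' hh']]].
  have [h hE] := homotopy0; exists h; apply: homotopy_step => x.
  by have /= -> := hE x; rewrite subrr linear0.
exists h'; apply: homotopy_step => x.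
by rewrite hh' addrK; apply/ires_exactS; exists (h x).
Qed.

End Homotopy.

Section RightDerived.
Variables (R : comNzRingType) (T : functor R) (T_add : additive_functor T).
Variable res : forall M : lmodType R, injective_resolution M.

Definition cocycles (M : lmodType R) n : submodule (T (res M n)) :=
  ker_submodule (fmap T (ires_d (res M) n)).

Definition coboundaries (M : lmodType R) n : submodule (T (res M n)) :=
  if n is n'.+1 then im_submodule (fmap T (ires_d (res M) n'))
  else zero_submodule (T (res M 0%N)).

Definition derived_obj n (M : lmodType R) : lmodType R :=
  subquotient (cocycles M n) (coboundaries M n).

Lemma fmap0 (M N : lmodType R) (f : {linear M -> N}) :
  f =1 (fun=> 0) -> fmap T f =1 (fun=> 0).
Proof.
move=> f0 x; have := T_add f f x.
rewrite (@fmap_ext _ T _ _ (f \+ f) f) => [|y]; last by rewrite /= f0 addr0.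
by move=> /= /(congr1 (fun z => z - fmap T f x)); rewrite subrr addrK.
Qed.

Lemma fmapB (M N : lmodType R) (f g : {linear M -> N}) :
  fmap T (f \- g) =1 fmap T f \- fmap T g.
Proof.
move=> x /=; apply/eqP; rewrite eq_sym subr_eq; apply/eqP.
rewrite -[RHS]/((fmap T (f \- g) \+ fmap T g) x) -T_add.
by apply: fmap_ext => y /=; rewrite subrK.
Qed.

Section Map.
Variables (M N : lmodType R) (phi : forall n, {linear res M n -> res N n}).
Hypothesis phi_chain : forall n,
  ires_d (res N) n \o phi n =1 phi n.+1 \o ires_d (res M) n.

Lemma T_chain n x :
  fmap T (ires_d (res N) n) (fmap T (phi n) x) =
  fmap T (phi n.+1) (fmap T (ires_d (res M) n) x).
Proof.
rewrite -[LHS]/((fmap T (ires_d (res N) n) \o fmap T (phi n)) x) -fmap_comp.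
rewrite -[RHS]/((fmap T (phi n.+1) \o fmap T (ires_d (res M) n)) x) -fmap_comp.
exact: fmap_ext.
Qed.

Lemma cocycles_map n x : cocycles M n x -> cocycles N n (fmap T (phi n) x).
Proof. by rewrite /= T_chain => ->; rewrite linear0. Qed.

Lemma coboundaries_map n x :
  coboundaries M n x -> coboundaries N n (fmap T (phi n) x).
Proof.
case: n x => [|n] x /=; first by move=> ->; rewrite linear0.
by move=> [y _ <-]; exists (fmap T (phi n) y) => //; rewrite T_chain.
Qed.

Definition cohomology_map n : {linear derived_obj n M -> derived_obj n N} :=
  subq_map (@cocycles_map n) (@coboundaries_map n).

End Map.

Lemma homotopic_coboundary (M N : lmodType R) (f : {linear M -> N})
    (phi psi : forall n, {linear res M n -> res N n}) n x :
  lifts f phi -> lifts f psi -> cocycles M n x ->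
  coboundaries N n (fmap T (phi n) x - fmap T (psi n) x).
Proof.
move=> phiL psiL; rewrite -[X in coboundaries N n X]/((fmap T (phi n) \- fmap T (psi n)) x) -fmapB.
case: n x => [|n] x /= xZ.
  have [h hE] := homotopy0 phiL psiL.
  rewrite -(@fmap_ext _ T _ _ (h \o ires_d (res M) 0) (phi 0%N \- psi 0%N)) //.
  by rewrite fmap_comp /= xZ linear0.
have [h [h' hh']] := homotopy phiL psiL n.
rewrite (@fmap_ext _ T _ _ (phi n.+1 \- psi n.+1)
  ((ires_d (res N) n \o h) \+ (h' \o ires_d (res M) n.+1))) //.
exists (fmap T h x) => //.
by rewrite T_add /= !fmap_comp /= xZ linear0 addr0.
Qed.

Definition chosen_lift (M N : lmodType R) (f : {linear M -> N}) :
    forall n, {linear res M n -> res N n} :=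
  sval (cid (lift_exists (res M) (res N) f)).

Lemma chosen_liftP (M N : lmodType R) (f : {linear M -> N}) :
  lifts f (chosen_lift f).
Proof. exact: (svalP (cid (lift_exists (res M) (res N) f))). Qed.

Definition derived_map n (M N : lmodType R) (f : {linear M -> N}) :
    {linear derived_obj n M -> derived_obj n N} :=
  cohomology_map (chosen_liftP f).2 n.

Lemma derived_mapE n (M N : lmodType R) (f : {linear M -> N})
    (phi : forall n, {linear res M n -> res N n}) (phiL : lifts f phi)
    x (xZ : cocycles M n x) :
  derived_map n f (subq_proj (coboundaries M n) xZ) =
  subq_proj (coboundaries N n) (cocycles_map phiL.2 xZ).
Proof.
rewrite /derived_map /cohomology_map subq_mapE; apply/subq_projP.
exact: homotopic_coboundary (chosen_liftP f) phiL xZ.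
Qed.

Lemma derived_map_ext n (M N : lmodType R) (f g : {linear M -> N}) :
  f =1 g -> derived_map n f =1 derived_map n g.
Proof.
move=> fg; have gL : lifts f (chosen_lift g).
  split=> [x|]; last exact: (chosen_liftP g).2.
  by rewrite -(chosen_liftP g).1 /= fg.
move=> q; have [x [xZ ->]] := subq_proj_surj q.
rewrite (derived_mapE gL) (derived_mapE (chosen_liftP g)); apply/subq_projP.
by rewrite subrr; have [] := submoduleP (coboundaries N n).
Qed.

Lemma derived_map_id n (M : lmodType R) :
  derived_map n (idfun : {linear M -> M}) =1 id.
Proof.
have idL : lifts (idfun : {linear M -> M})
  (fun k => (idfun : {linear res M k -> res M k})) by [].
move=> q; have [x [xZ ->]] := subq_proj_surj q.
rewrite (derived_mapE idL); apply/subq_projP; rewrite fmap_id subrr.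
by have [] := submoduleP (coboundaries M n).
Qed.

Lemma derived_map_comp n (M N P : lmodType R) (f : {linear M -> N})
    (g : {linear N -> P}) :
  derived_map n (g \o f) =1 derived_map n g \o derived_map n f.
Proof.
have [fL gL] := (chosen_liftP f, chosen_liftP g).
have gfL : lifts (g \o f) (fun k => chosen_lift g k \o chosen_lift f k).
  have [[f0 fS] [g0 gS]] := (fL, gL).
  split=> [x|k x] /=.
    by have /= -> := g0 (f x); have /= -> := f0 x.
  by have /= -> := gS k (chosen_lift f k x); have /= -> := fS k x.
move=> q; have [x [xZ ->]] := subq_proj_surj q.
rewrite (derived_mapE gfL) [RHS]/comp (derived_mapE fL) (derived_mapE gL).
apply/subq_projP; rewrite fmap_comp /= subrr.
by have [] := submoduleP (coboundaries P n).
Qed.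

Definition right_derived (n : nat) : functor R :=
  Functor (@derived_map_ext n) (@derived_map_id n) (@derived_map_comp n).

End RightDerived.

Definition is_int_rat : rat -> bool := fun x => x \is a Num.int.

Lemma is_int_rat_closed : zmod_closed is_int_rat.
Proof. by split=> [|x y]; [exact: rpred0|exact: rpredB]. Qed.

HB.instance Definition _ := GRing.isZmodClosed.Build rat is_int_rat is_int_rat_closed.

Definition int_rat : zmodClosed rat := Algebra.ZmodClosed.clone rat is_int_rat _.
Definition QZ : zmodType := Quotient.quot int_rat.
Definition QZ_proj (x : rat) : QZ := (\pi_(Quotient.quot int_rat) x)%qT.

Lemma QZ_projD x y : QZ_proj (x + y) = QZ_proj x + QZ_proj y.
Proof. exact: raddfD. Qed.

Lemma QZ_projMn x n : QZ_proj (x *+ n) = QZ_proj x *+ n.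
Proof. exact: raddfMn. Qed.

Lemma QZ_proj_eq0 x : QZ_proj x = 0 <-> x \is a Num.int.
Proof.
have E : QZ_proj 0 = 0 by exact: raddf0.
have := Quotient.idealrBE int_rat x 0; rewrite subr0 => H.
by rewrite -E; split => [/eqP e|xi]; [rewrite H|apply/eqP; rewrite -H].
Qed.

Lemma QZ_surj (y : QZ) : exists x, QZ_proj x = y.
Proof. by exists (repr y); exact: reprK. Qed.

Lemma QZ_divisible (y : QZ) k : (0 < k)%N -> exists z, z *+ k = y.
Proof.
move=> k0; have [x <-] := QZ_surj y; exists (QZ_proj (x / k%:R)).
by rewrite -QZ_projMn -(mulr_natr (x / k%:R)) divfK// pnatr_eq0 -lt0n.
Qed.

Lemma QZ_torsion k : (1 < k)%N -> exists2 y : QZ, y != 0 & y *+ k = 0.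
Proof.
move=> k1; have k0 : (k%:R : rat) != 0 by rewrite pnatr_eq0 -lt0n ltnW.
exists (QZ_proj k%:R^-1); last first.
  rewrite -QZ_projMn -(mulr_natr k%:R^-1) mulVf//; apply/QZ_proj_eq0; exact: rpred1.
apply/eqP => /QZ_proj_eq0 /intrP[z zE].
have : (k%:R * k%:R^-1 : rat) = 1 by rewrite divff.
rewrite zE -[k%:R]/((k%:Z)%:~R) -intrM => /eqP; rewrite -[1]/(1%:~R) eqr_int => /eqP.
move=> /(congr1 absz)/eqP; rewrite abszM absz_nat muln_eq1 => /andP[/eqP kE _].
by rewrite kE in k1.
Qed.

Section ExtendAdditive.
Variable V : zmodType.

(* G is the graph of an additive map from a subgroup of V to QZ *)
Definition pgraph (G : set (V * QZ)%type) : Prop :=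
  [/\ G 0, forall p q, G p -> G q -> G (p - q) & forall y, G (0, y) -> y = 0].

Definition adjoin (G : set (V * QZ)%type) v y : set (V * QZ)%type :=
  [set p | exists q (j : int), G q /\ p = (q.1 + v *~ j, q.2 + y *~ j)].

Lemma pgraphN G p : pgraph G -> G p -> G (- p).
Proof. by move=> [G0 GB _] Gp; rewrite -sub0r; exact: GB. Qed.

Lemma pgraphD G p q : pgraph G -> G p -> G q -> G (p + q).
Proof.
by move=> Gp Gp' Gq; rewrite -[q]opprK; have [_ GB _] := Gp; apply: GB => //; exact: pgraphN.
Qed.

Lemma pgraphMn G p n : pgraph G -> G p -> G (p *+ n).
Proof.
move=> GG Gp; elim: n => [|n IH]; first by have [] := GG.
by rewrite mulrS; exact: pgraphD.
Qed.

Lemma pgraphMz G p (j : int) : pgraph G -> G p -> G (p *~ j).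
Proof.
move=> GG Gp; case: j => n; first exact: pgraphMn.
by rewrite NegzE mulrNz; apply: pgraphN => //; exact: pgraphMn.
Qed.

Lemma pair_mulrz (v : V) (y : QZ) (j : int) : (v, y) *~ j = (v *~ j, y *~ j).
Proof.
have E n : (v, y) *+ n = (v *+ n, y *+ n).
  by elim: n => // n IH; rewrite !mulrS IH.
by case: j => n; [exact: E|rewrite NegzE !mulrNz -[LHS]/(- ((v, y) *+ n.+1)) E].
Qed.

Lemma sub_adjoin G v y : G `<=` adjoin G v y.
Proof. by move=> q Gq; exists q, 0; rewrite !mulr0z !addr0; split => //; case: q Gq. Qed.

Lemma mem_adjoin G v y : pgraph G -> adjoin G v y (v, y).
Proof. by move=> [G0 _ _]; exists 0, 1; rewrite !mulr1z !add0r. Qed.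

Lemma adjoin_pgraph G v y : pgraph G ->
  (forall j : int, forall z, G (v *~ j, z) -> z = y *~ j) -> pgraph (adjoin G v y).
Proof.
move=> GG Gv; have [G0 GB Gf] := GG; split.
- exact: sub_adjoin.
- move=> _ _ [p [j [Gp ->]]] [q [k [Gq ->]]]; exists (p - q), (j - k).
  split; first exact: GB.
  by rewrite !mulrzBr; congr pair; rewrite /= opprD addrACA.
- move=> z [[a b] [j [Gq [/= /eqP a0 ->]]]].
  have aE : a = - (v *~ j) by apply/eqP; rewrite -addr_eq0 eq_sym.
  have /Gv -> : G (v *~ (- j), b) by rewrite mulrNz -aE.
  by rewrite mulrNz addNr.
Qed.

Lemma adjoin_exists G v : pgraph G -> exists y,
  (forall j : int, forall z, G (v *~ j, z) -> z = y *~ j) /\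
  ((forall z, ~ G (v, z)) -> (forall v' z, G (v', z) -> z = 0) -> y != 0).
Proof.
move=> GG; have [G0 GB Gf] := GG.
have Gu a b c : G (a, b) -> G (a, c) -> b = c.
  move=> /GB h /h; rewrite -[_ - _]/(a - a, b - c) subrr => /Gf /eqP.
  by rewrite subr_eq0 => /eqP.
have [exk|nok] := pselect (exists k, (0 < k)%N && `[< exists z, G (v *+ k, z) >]); last first.
  have [y y0 _] := @QZ_torsion 2 isT; exists y; split => // j z Gj.
  have : j = 0; last by move=> j0; move: Gj; rewrite j0 !mulr0z; exact: Gf.
  apply: contrapT => j0; apply: nok; exists `|j|%N; rewrite absz_gt0; apply/andP; split; first exact/eqP.
  apply/asboolP; case: j j0 Gj => n j0 Gj; first by exists z.
  exists (- z); rewrite [`|_|%N]/=; have := pgraphN GG Gj.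
  by rewrite NegzE mulrNz -[X in G X -> _]/(- - (v *+ n.+1), - z) opprK.
case: (ex_minnP exk) => k /andP[kgt0 /asboolP[w Gw]] kmin.
have key y : y *+ k = w -> forall j : int, forall z, G (v *~ j, z) -> z = y *~ j.
  move=> yk j z Gj.
  have jE := divz_eq j k.
  have Gq := pgraphMz (j %/ k)%Z GG Gw.
  rewrite pair_mulrz in Gq.
  have Gr := GB _ _ Gj Gq.
  have rge0 : (0 <= (j %% k)%Z) by rewrite modz_ge0// -lt0n.
  have rltk : ((j %% k)%Z < k) by rewrite ltz_pmod.
  have vr : v *~ j - v *+ k *~ (j %/ k)%Z = v *~ (j %% k)%Z.
    by rewrite {1}jE mulrzDr [(_ * k%:Z)]mulrC mulrzA addrC addKr.
  rewrite -[_ - _]/(v *~ j - v *+ k *~ (j %/ k)%Z, z - w *~ (j %/ k)%Z) vr in Gr.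
  have r0 : (j %% k)%Z = 0.
    case: (j %% k)%Z rge0 rltk Gr => // n _ nk Gr.
    case: n nk Gr => // n nk Gr.
    rewrite ltz_nat in nk.
    have : (k <= n.+1)%N.
      by apply: kmin; apply/andP; split => //; apply/asboolP; eexists; exact: Gr.
    by rewrite leqNgt nk.
  rewrite r0 mulr0z in Gr; have /eqP := Gf _ Gr; rewrite subr_eq0 => /eqP ->.
  by rewrite -yk [j in RHS]jE r0 addr0 [(_ * k%:Z)]mulrC mulrzA.
have [w0|/eqP w0] := pselect (w = 0); last first.
  have [y yk] := QZ_divisible w kgt0; exists y; split; first exact: key.
  by move=> _ Gz; case/eqP: w0; exact: Gz Gw.
have [k1|k1] := ltnP 1 k.
  have [y y0 yk] := QZ_torsion k1; exists y; split => //; apply: key.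
  by rewrite yk w0.
have k1E : k = 1%N by apply/eqP; rewrite eqn_leq k1.
exists 0; split; first by apply: key; rewrite mul0rn w0.
by move=> /(_ w) []; rewrite k1E in Gw.
Qed.

Definition is_additive (f : V -> QZ) : Prop := forall x y, f (x + y) = f x + f y.

Lemma extend_pgraph G0 : pgraph G0 -> exists f : V -> QZ,
  is_additive f /\ forall v y, G0 (v, y) -> f v = y.
Proof.
move=> GG0.
pose P (G : set (V * QZ)%type) := G = set0 \/ (pgraph G /\ G0 `<=` G).
have [F FP Ftot|A [PA Amax]] := @Zorn_bigcup _ P.
  have [[X [FX Xn]]|F0] := pselect (exists X, F X /\ X <> set0); last first.
    left; rewrite -subset0 => p [X FX Xp]; case: F0; exists X; split => //.
    by move=> X0; rewrite X0 in Xp.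
  right; have PX : pgraph X /\ G0 `<=` X by case: (FP _ FX) => [/Xn|].
  have pg Y p : F Y -> Y p -> pgraph Y.
    by move=> FY Yp; case: (FP _ FY) => [Y0|[]//]; rewrite Y0 in Yp.
  split; last by move=> p G0p; exists X => //; exact: PX.2.
  split.
  - by exists X => //; have [[]] := PX.
  - move=> p q [Y FY Yp] [Z FZ Zq].
    have [YZ|ZY] := Ftot _ _ FY FZ.
      by exists Z => //; have [_ ZB _] := pg _ _ FZ Zq; apply: ZB => //; exact: YZ.
    by exists Y => //; have [_ YB _] := pg _ _ FY Yp; apply: YB => //; exact: ZY.
  - by move=> y [Y FY Yy]; have [_ _] := pg _ _ FY Yy; apply.
have [GA G0A] : pgraph A /\ G0 `<=` A.
  case: PA => // A0; exfalso; apply: (Amax G0); last by right; split.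
  rewrite A0; split; first exact: sub0set.
  by have [h _ _] := GG0; move=> /(_ _ h).
have dom v : exists y, A (v, y).
  have [y [yA _]] := adjoin_exists v GA; exists y.
  apply: contrapT => nA; apply: (Amax (adjoin A v y)).
    by split; [exact: sub_adjoin|move=> /(_ _ (mem_adjoin _ _ GA))].
  right; split; first exact: adjoin_pgraph.
  exact: subset_trans G0A (@sub_adjoin _ _ _).
have [_ AB Af] := GA.
have Au a b c : A (a, b) -> A (a, c) -> b = c.
  move=> /AB h /h; rewrite -[_ - _]/(a - a, b - c) subrr => /Af /eqP.
  by rewrite subr_eq0 => /eqP.
have [f fA] := choice dom.
exists f; split=> [x y|v y G0v]; last by apply: Au (fA v) _; exact: G0A.
by apply: Au (fA _) _; exact: (pgraphD GA (fA x) (fA y)).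
Qed.

Lemma separating (v : V) : v <> 0 -> exists2 f, is_additive f & f v <> 0.
Proof.
move=> v0.
have GG : pgraph [set (0 : V * QZ)%type].
  split => //= [p q -> ->|y [->]//]; by rewrite subrr.
have [y [yG ynz]] := adjoin_exists v GG.
have [f [fA fG]] := extend_pgraph (adjoin_pgraph GG yG).
exists f => //; rewrite (fG _ _ (mem_adjoin _ _ GG)); apply/eqP/ynz.
  by move=> z [].
by move=> v' z [].
Qed.

End ExtendAdditive.

Section EnoughInjectives.
Variables (R : comNzRingType) (M : lmodType R).

(* The functions [phi : R * (M -> QZ) -> QZ] that are additive in the first
   variable form the product, over all [chi : M -> QZ], of copies of the
   injective module Hom_Z(R, QZ), on which [a : R] acts by
   (a *: phi) (r, chi) = phi (r * a, chi) *)
Definition inj_env_fun := (R * (M -> QZ) -> QZ)%type.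

Definition inj_env_pred : inj_env_fun -> bool := fun phi =>
  `[< forall (chi : M -> QZ) (r s : R), phi (r + s, chi) = phi (r, chi) + phi (s, chi) >].

Lemma inj_env_closed : zmod_closed inj_env_pred.
Proof.
split; first by apply/asboolP => chi r s; rewrite addr0.
move=> f g /asboolP fA /asboolP gA; apply/asboolP => chi r s.
by rewrite -![(f - g) _]/(f _ - g _) fA gA opprD addrACA.
Qed.

HB.instance Definition _ :=
  GRing.isZmodClosed.Build inj_env_fun inj_env_pred inj_env_closed.

Definition inj_env : Type := {phi : inj_env_fun | inj_env_pred phi}.
HB.instance Definition _ := SubChoice.on inj_env.
HB.instance Definition _ :=
  GRing.SubChoice_isSubZmodule.Build inj_env_fun inj_env_pred inj_env inj_env_closed.

Lemma inj_envP (phi : inj_env) chi r s :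
  val phi (r + s, chi) = val phi (r, chi) + val phi (s, chi).
Proof. by have /asboolP := valP phi. Qed.

Lemma inj_env_scale_subproof (a : R) (phi : inj_env) :
  inj_env_pred (fun p => val phi (p.1 * a, p.2)).
Proof. by apply/asboolP => chi r s /=; rewrite mulrDl inj_envP. Qed.

Definition inj_env_scale (a : R) (phi : inj_env) : inj_env :=
  exist (fun phi => inj_env_pred phi) _ (inj_env_scale_subproof a phi).

Lemma inj_env_ext (phi psi : inj_env) :
  (forall r chi, val phi (r, chi) = val psi (r, chi)) -> phi = psi.
Proof. by move=> h; apply/val_inj/funext => -[]. Qed.

Lemma inj_env_scalerA a b phi :
  inj_env_scale a (inj_env_scale b phi) = inj_env_scale (a * b) phi.
Proof. by apply: inj_env_ext => r chi /=; rewrite mulrA. Qed.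

Lemma inj_env_scale1r : left_id 1 inj_env_scale.
Proof. by move=> phi; apply: inj_env_ext => r chi /=; rewrite mulr1. Qed.

Lemma inj_env_scalerDr : right_distributive inj_env_scale +%R.
Proof. by move=> a phi psi; apply: inj_env_ext. Qed.

Lemma inj_env_scalerDl phi : {morph inj_env_scale^~ phi : a b / a + b}.
Proof.
by move=> a b; apply: inj_env_ext => r chi; rewrite /= mulrDr inj_envP.
Qed.

HB.instance Definition _ := GRing.Zmodule_isLmodule.Build R inj_env
  inj_env_scalerA inj_env_scale1r inj_env_scalerDr inj_env_scalerDl.

Lemma inj_env_injective : injective_module inj_env.
Proof.
move=> A B i f i_inj.
have ext chi : exists g : B -> QZ,
    is_additive g /\ forall a, g (i a) = val (f a) (1, chi).
  pose G : set (B * QZ)%type := [set p | exists a, p = (i a, val (f a) (1, chi))].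
  have GG : pgraph G.
    split.
    - by exists 0; rewrite !linear0.
    - by move=> p q [a ->] [b ->]; exists (a - b); rewrite !linearB.
    - move=> y [a [ia ->]]; have -> : a = 0 by apply: i_inj; rewrite linear0.
      by rewrite linear0.
  have [g [gA gG]] := extend_pgraph GG.
  by exists g; split => // a; apply: gG; exists a.
have [g gP] := choice ext.
have gA chi := (gP chi).1.
have sub b : inj_env_pred (fun p => g p.2 (p.1 *: b)).
  by apply/asboolP => chi r s /=; rewrite scalerDl gA.
pose h (b : B) : inj_env := exist (fun phi => inj_env_pred phi) _ (sub b).
have hlin : linear h.
  move=> a x y; apply: inj_env_ext => r chi.
  by rewrite /= scalerDr gA scalerA.
exists (mk_linear hlin) => a; apply: inj_env_ext => r chi /=.
rewrite -linearZ_LR (gP chi).2 linearZ_LR /=.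
by rewrite mul1r.
Qed.

Lemma inj_env_embedding : exists j : {linear M -> inj_env}, injective j.
Proof.
pose j0 (x : M) : inj_env_fun :=
  fun p => if `[< is_additive p.2 >] then p.2 (p.1 *: x) else 0.
have sub x : inj_env_pred (j0 x).
  apply/asboolP => chi r s; rewrite /j0 /=; case: asboolP => [chiA|_].
    by rewrite scalerDl chiA.
  by rewrite addr0.
pose j (x : M) : inj_env := exist (fun phi => inj_env_pred phi) _ (sub x).
have jlin : linear j.
  move=> a x y; apply: inj_env_ext => r chi; rewrite /= /j0 /=.
  rewrite -[RHS]/(j0 x (r * a, chi) + j0 y (r, chi)) /j0 /=.
  case: asboolP => [chiA|_]; last by rewrite addr0.
  by rewrite scalerDr chiA scalerA.
exists (mk_linear jlin); apply: raddf_inj => x jx0.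
apply: contrapT => /separating[chi chiA]; apply.
have := congr1 (fun phi : inj_env => val phi (1, chi)) jx0.
by rewrite /= /j0 /=; rewrite asboolT// scale1r.
Qed.

End EnoughInjectives.

Section Resolution.
Variables (R : comNzRingType) (M : lmodType R).

Definition embed (N : lmodType R) : {linear N -> inj_env N} :=
  sval (cid (inj_env_embedding N)).

Lemma embed_inj (N : lmodType R) : injective (embed N).
Proof. exact: (svalP (cid (inj_env_embedding N))). Qed.

Fixpoint cosyzygy (n : nat) : lmodType R :=
  if n is n'.+1 then quot_type (im_submodule (embed (cosyzygy n'))) else M.

Definition res_d n : {linear inj_env (cosyzygy n) -> inj_env (cosyzygy n.+1)} :=
  embed (cosyzygy n.+1) \o quot_proj (im_submodule (embed (cosyzygy n))).

Lemma res_d_eq0 n x : res_d n x = 0 <-> exists y, embed (cosyzygy n) y = x.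
Proof.
split=> [|[y <-]].
  rewrite -[0](linear0 (embed (cosyzygy n.+1))) => /embed_inj.
  rewrite -[0](linear0 (quot_proj (im_submodule (embed (cosyzygy n))))).
  by move=> /quot_projP; rewrite subr0 => -[y _ <-]; exists y.
rewrite /res_d /= -[RHS](linear0 (embed (cosyzygy n.+1))); congr (embed _ _).
rewrite -[RHS](linear0 (quot_proj (im_submodule (embed (cosyzygy n))))).
by apply/quot_projP; rewrite subr0; exists y.
Qed.

Lemma res_exactS n x : res_d n.+1 x = 0 <-> exists y, res_d n y = x.
Proof.
split=> [/res_d_eq0[q <-]|[y <-]]; last by apply/res_d_eq0; eexists.
by exists (quot_repr q); rewrite /res_d /= quot_reprK.
Qed.

Definition std_resolution : injective_resolution M :=
  @InjRes R M (fun n => inj_env (cosyzygy n)) (embed M) res_d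
    (fun n => @inj_env_injective R (cosyzygy n)) (@embed_inj M)
    (@res_d_eq0 0%N) res_exactS.

End Resolution.

Definition is_ideal (R : comNzRingType) (I : set R) : Prop :=
  @is_submodule R R^o I.

Fixpoint ideal_pow (R : comNzRingType) (I : set R) (n : nat) : set R :=
  if n is n'.+1 then
    smallest (@is_ideal R) [set a * b | a in I & b in ideal_pow I n']
  else setT.

Section Torsion.
Variables (R : comNzRingType) (m : set R).

Lemma smallest_ideal (A : set R) : is_ideal (smallest (@is_ideal R) A).
Proof.
split=> [I [[]]//|x y Ax Ay I /= IA|a x Ax I /= IA].
- by have [[_ ID _] _] := IA; apply: ID; [exact: Ax|exact: Ay].
- by have [[_ _ IZ] _] := IA; apply: IZ; exact: Ax.
Qed.

Lemma ideal_pow_ideal n : is_ideal (ideal_pow m n).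
Proof. by case: n => [|n] //; exact: smallest_ideal. Qed.

Lemma ideal_pow_decr i j : (i <= j)%N -> ideal_pow m j `<=` ideal_pow m i.
Proof.
move=> /subnK <-; elim: (j - i)%N => [|k IH] //; rewrite addSn.
apply: subset_trans IH => x; apply; split; first exact: ideal_pow_ideal.
move=> _ [a ma [b mb <-]].
by have [_ _ IZ] := ideal_pow_ideal (k + i); exact: IZ.
Qed.

Lemma torsion_is_submodule (M : lmodType R) :
  is_submodule [set x : M | exists n, forall a, ideal_pow m n a -> a *: x = 0].
Proof.
split=> [|x y [i ix] [j jy]|b x [i ix]].
- by exists 0%N => a _; rewrite scaler0.
- exists (maxn i j) => a aij; rewrite scalerDr ix ?jy ?addr0//.
    exact: ideal_pow_decr (leq_maxr i j) _ aij.
  exact: ideal_pow_decr (leq_maxl i j) _ aij.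
- by exists i => a ai; rewrite scalerA mulrC -scalerA ix// scaler0.
Qed.

Definition torsion_submodule (M : lmodType R) : submodule M :=
  Submodule (torsion_is_submodule M).

Lemma torsion_map (M N : lmodType R) (f : {linear M -> N}) x :
  torsion_submodule M x -> torsion_submodule N (f x).
Proof. by move=> [n nx]; exists n => a /nx ax; rewrite -linearZ_LR ax linear0. Qed.

Definition torsion_fmap_fun (M N : lmodType R) (f : {linear M -> N})
    (x : submod_type (torsion_submodule M)) : submod_type (torsion_submodule N) :=
  submod_elt (torsion_map f (submod_valP x)).

Lemma torsion_fmap_linear (M N : lmodType R) (f : {linear M -> N}) :
  linear (torsion_fmap_fun f).
Proof. by move=> a x y; apply/val_inj; rewrite /= linearP. Qed.

Definition torsion_functor : functor R.
Proof.
refine (@Functor R (fun M => submod_type (torsion_submodule M))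
  (fun M N f => mk_linear (torsion_fmap_linear f)) _ _ _).
- by move=> M N f g fg x; apply/val_inj; exact: fg.
- by move=> M x; exact/val_inj.
- by move=> M N P f g x; exact/val_inj.
Defined.

Lemma torsion_functor_additive : additive_functor torsion_functor.
Proof. by move=> M N f g x; exact/val_inj. Qed.

Definition local_cohomology (n : nat) : functor R :=
  right_derived torsion_functor_additive (@std_resolution R) n.

End Torsion.

Definition noetherian (R : comNzRingType) : Prop :=
  forall I : set R, is_ideal I ->
    exists s : seq R, I = smallest (@is_ideal R) [set` s].

Definition is_maximal (R : comNzRingType) (I : set R) : Prop :=
  [/\ is_ideal I, ~ I 1 &
      forall J : set R, is_ideal J -> ~ J 1 -> I `<=` J -> J = I].

Definition is_local (R : comNzRingType) (m : set R) : Prop :=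
  is_maximal m /\ forall n : set R, is_maximal n -> n = m.

(* The canonical map from R to the inverse limit of the R / I^n is bijective;
   an element of the limit is represented by lifts [u n] of its components *)
Definition adic_complete (R : comNzRingType) (I : set R) : Prop :=
  forall u : nat -> R, (forall n, ideal_pow I n (u n.+1 - u n)) ->
    exists! l : R, forall n, ideal_pow I n (u n - l).

Definition is_prime (R : comNzRingType) (P : set R) : Prop :=
  [/\ is_ideal P, ~ P 1 & forall a b, P (a * b) -> P a \/ P b].

Definition has_prime_chain (R : comNzRingType) (n : nat) : Prop :=
  exists P : nat -> set R, (forall i, (i <= n)%N -> is_prime (P i)) /\
    (forall i, (i < n)%N -> P i `<` P i.+1).

Definition krull_dim (R : comNzRingType) (d : nat) : Prop :=
  has_prime_chain R d /\ forall n, has_prime_chain R n -> (n <= d)%N.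

Definition regular_sequence (R : comNzRingType) (s : seq R) : Prop :=
  let J i := smallest (@is_ideal R) [set` take i s] in
  (forall i x, (i < size s)%N -> J i (s`_i * x) -> J i x) /\ ~ J (size s) 1.

Definition has_depth (R : comNzRingType) (m : set R) (n : nat) : Prop :=
  let in_m s := {in s, forall x, m x} in
  (exists s : seq R, [/\ in_m s, regular_sequence s & size s = n]) /\
  (forall s : seq R, in_m s -> regular_sequence s -> (size s <= n)%N).

Definition cohen_macaulay (R : comNzRingType) (m : set R) : Prop :=
  exists n, krull_dim R n /\ has_depth m n.

(* Main.v *)
(* Since R is Cohen-Macaulay, some regular sequence x = (x_1, ..., x_d) generates
   an ideal whose radical is m, and the same holds for the powers
   x^n = (x_1^n, ..., x_d^n), which may moreover be permuted.  Dimension shifting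
   along x^n identifies Ext^d(R/(x^n), M) with M/(x^n)M, so that H^d(M) is the
   union of the images of the modules M/(x^n)M.

   Hence every element of H^d(M) is the image of an element of H^d(R) under
   some linear map R -> M, and this property passes to the two summands F and G
   of H^d: if one of them vanishes at R then it vanishes everywhere.

   Moreover the image of R/(x^n) in H^d(R) is exactly the annihilator of (x^n), by
   the formula (x^(n+k)) : (x^n) = (x^(n+k)) + ((x_1...x_d)^k).  So an idempotent
   endomorphism of H^d(R) acts on each of these cyclic submodules, as 0 or as the
   identity because R is local; as they are nested, it is 0 or the identity, and
   F or G vanishes at R. *)

Require Import Defs.
From HB Require Import structures.
From mathcomp Require Import all_boot all_order all_algebra.
From mathcomp Require Import boolp classical_sets functions.
From mathcomp Require Import ring.

Set Implicit Arguments.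
Unset Strict Implicit.
Unset Printing Implicit Defensive.

Import GRing.Theory.
Local Open Scope classical_set_scope.
Local Open Scope ring_scope.

(** * Ideals, generators and powers *)

Section Ideals.
Variable R : comNzRingType.
Implicit Types (I J P : set R) (s t : seq R).

Lemma ideal0 I : is_ideal I -> I 0.
Proof. by case. Qed.

Lemma idealD I x y : is_ideal I -> I x -> I y -> I (x + y).
Proof. by case=> _ ID _; exact: ID. Qed.

Lemma idealM I a x : is_ideal I -> I x -> I (a * x).
Proof. by case=> _ _ IM; exact: IM. Qed.

Lemma ideal1 I x : is_ideal I -> I 1 -> I x.
Proof. by move=> II I1; rewrite -[x]mulr1; exact: idealM. Qed.

Lemma ideal_exp I x n : is_ideal I -> I x -> I (x ^+ n.+1).
Proof. by move=> II Ix; rewrite exprSr; exact: idealM. Qed.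

Definition igen s : set R := smallest (@is_ideal R) [set` s].

Lemma igen_ideal s : is_ideal (igen s).
Proof. exact: smallest_ideal. Qed.

Lemma igen_mem s x : x \in s -> igen s x.
Proof. by move=> xs I [_]; apply. Qed.

Lemma igen_le s I : is_ideal I -> (forall x, x \in s -> I x) -> igen s `<=` I.
Proof. by move=> II sI r; apply. Qed.

Lemma igen_sub s t : {subset s <= t} -> igen s `<=` igen t.
Proof.
by move=> st; apply: igen_le => [|x /st xt]; [exact: igen_ideal|exact: igen_mem].
Qed.

Definition add_gen I x : set R := [set r | exists a b, I b /\ r = a * x + b].

Lemma add_gen_ideal I x : is_ideal I -> is_ideal (add_gen I x).
Proof.
move=> II; split.
- by exists 0, 0; split; [exact: ideal0|rewrite mul0r addr0].
- move=> _ _ [a [b [Ib ->]]] [a' [b' [Ib' ->]]]; exists (a + a'), (b + b').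
  by split; [exact: idealD|rewrite mulrDl addrACA].
- move=> c _ [a [b [Ib ->]]]; exists (c * a), (c * b).
  by split; [exact: idealM|rewrite -mulrA -mulrDr].
Qed.

Lemma add_gen_sub I x : I `<=` add_gen I x.
Proof. by move=> r Ir; exists 0, r; rewrite mul0r add0r. Qed.

Lemma add_gen_mem I x : is_ideal I -> add_gen I x x.
Proof. by move=> II; exists 1, 0; split; [exact: ideal0|rewrite mul1r addr0]. Qed.

Lemma igen_consW x s r : igen s r -> igen (x :: s) r.
Proof. by apply: igen_sub => y ys; rewrite inE ys orbT. Qed.

Lemma igen_cons x s r : igen (x :: s) r <-> add_gen (igen s) x r.
Proof.
split.
  apply: igen_le; first exact/add_gen_ideal/igen_ideal.
  move=> y; rewrite inE => /predU1P[->|ys]; first exact/add_gen_mem/igen_ideal.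
  by apply: add_gen_sub; exact: igen_mem.
move=> [a [b [sb ->]]]; have xsI := igen_ideal (x :: s).
apply: (idealD xsI).
  by apply: (idealM _ xsI); apply: igen_mem; rewrite mem_head.
exact: igen_consW.
Qed.

Lemma colon_ideal I a : is_ideal I -> is_ideal [set r | I (a * r)].
Proof.
move=> II; split => [|x y Ix Iy|b x Ix] /=.
- by rewrite mulr0; exact: ideal0.
- by rewrite mulrDr; exact: idealD.
- by rewrite -[_ *: _]/(b * x) mulrCA; exact: idealM.
Qed.

(** Powers are built one factor at a time: a factor [a] is peeled off by passing from [J] to the
    colon ideal (J : a). *)
Lemma ideal_pow_add I J i j : is_ideal J ->
  (forall a b, ideal_pow I i a -> ideal_pow I j b -> J (a * b)) ->
  ideal_pow I (i + j) `<=` J.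
Proof.
elim: i J => [|i IH] J JI ab; first by move=> b Ib; rewrite -[b]mul1r; exact: ab.
rewrite addSn => r; apply; split=> // _ [a Ia [b Ib <-]].
apply: (IH [set r | J (a * r)]) Ib; first exact: colon_ideal.
move=> a' b' Ia' Ib'; rewrite /= mulrA; apply: ab => // K [_]; apply.
by exists a => //; exists a'.
Qed.

Lemma ideal_pow_exp I x n : I x -> ideal_pow I n (x ^+ n).
Proof.
move=> Ix; elim: n => [//|n IH]; rewrite exprS => K [_]; apply.
by exists x => //; exists (x ^+ n).
Qed.

End Ideals.

(** * Noetherian local rings: maximal ideals in a family, primes, Nakayama's lemma *)

Section Noetherian.
Variables (R : comNzRingType) (noethR : noetherian R).
Implicit Types (I J P : set R).

(** Otherwise choice gives a strictly increasing chain, whose union is finitely generated and hence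
    contained in one of its terms. *)
Lemma noetherian_maximal (Q : set R -> Prop) I0 :
  (forall I, Q I -> is_ideal I) -> Q I0 ->
  exists I, [/\ Q I, I0 `<=` I & forall J, Q J -> I `<=` J -> J `<=` I].
Proof.
move=> QI QI0; apply: contrapT => nomax.
pose S := {I | Q I /\ I0 `<=` I}.
have next (I : S) : exists J : S, sval I `<` sval J.
  case: I => I [QI_ I0I] /=; apply: contrapT => noJ; apply: nomax.
  exists I; split=> // J QJ IJ; apply: contrapT => nJI; apply: noJ.
  by exists (exist _ J (conj QJ (subset_trans I0I IJ))).
have [f fP] := choice next.
pose c k := sval (iter k f (exist _ I0 (conj QI0 (@subset_refl _ I0)) : S)).
have cI k : is_ideal (c k) by apply: QI; exact: (svalP (iter k f _)).1.
have cS k : c k `<` c k.+1 by rewrite /c iterS; exact: fP.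
have cle i j : (i <= j)%N -> c i `<=` c j.
  move=> /subnK <-; elim: (j - i)%N => [|k IH] //.
  by rewrite addSn; apply: subset_trans IH _; exact: (cS _).1.
pose U : set R := [set r | exists k, c k r].
have UI : is_ideal U.
  split=> [|x y [i ix] [j jy]|a x [i ix]].
  - by exists 0%N; exact: (ideal0 (cI 0%N)).
  - exists (maxn i j); apply: (idealD (cI _)).
      by apply: cle ix; exact: leq_maxl.
    by apply: cle jy; exact: leq_maxr.
  - by exists i; exact: (idealM a (cI i) ix).
have [s sU] := noethR UI.
have [k ks] : exists k, forall x, x \in s -> c k x.
  have sU' x : x \in s -> U x by move=> xs; rewrite sU; exact: igen_mem.
  elim: {sU} s sU' => [|x s IH] sU'; first by exists 0%N.
  have [|k ks] := IH; first by move=> y ys; apply: sU'; rewrite inE ys orbT.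
  have [j jx] := sU' x (mem_head _ _).
  exists (maxn k j) => y; rewrite inE => /predU1P[->|ys].
    by apply: cle jx; exact: leq_maxr.
  by apply: cle (ks _ ys); exact: leq_maxl.
have Uk : U `<=` c k by rewrite sU; exact: igen_le.
by have [_] := cS k; apply=> x ckx; apply: Uk; exists k.+1.
Qed.

(** An ideal [P] maximal among those containing [I] and missing [S] is prime: for [a] and [b]
    outside [P], both P + (a) and P + (b) meet [S], and a product of elements of these lies in P +
    (ab). *)
Lemma avoiding_prime I (S : set R) : is_ideal I -> S 1 ->
  (forall a b, S a -> S b -> S (a * b)) -> (forall a, I a -> ~ S a) ->
  exists P, [/\ is_prime P, I `<=` P & forall a, P a -> ~ S a].
Proof.
move=> II S1 SM IS.
have [|//|P [[PI PS] IP Pmax]] :=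
  @noetherian_maximal (fun J => is_ideal J /\ forall a, J a -> ~ S a) I.
  by move=> J [].
exists P; split=> //; split=> //; first by move=> /PS.
move=> a b Pab; apply: contrapT => /not_orP[nPa nPb].
have meet x : ~ P x -> exists2 y, add_gen P x y & S y.
  move=> nPx; apply: contrapT => nS; apply/nPx/(Pmax (add_gen P x)).
  - by split=> [|y Py Sy]; [exact: add_gen_ideal|apply: nS; exists y].
  - exact: add_gen_sub.
  - exact: add_gen_mem.
have [_ [u [p [Pp ->]]] Sx] := meet _ nPa.
have [_ [v [q [Pq ->]]] Sy] := meet _ nPb.
apply: (PS _ _ (SM _ _ Sx Sy)).
rewrite (_ : _ * _ = (u * v) * (a * b) + ((v * b + q) * p + (u * a) * q));
  last by ring.
by do ?[apply: idealD => //]; exact: idealM.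
Qed.

(* Avoid the multiplicative set of the products [s * x ^+ n] with [s] outside
   of [P]. *)
Lemma smaller_prime I P x : is_ideal I -> is_prime P -> I `<=` P -> P x ->
  (forall r, I (x * r) -> I r) ->
  exists P', [/\ is_prime P', I `<=` P' & P' `<` P].
Proof.
move=> II [PI P1 PM] IP Px xnzd.
have xnzdX n r : I (x ^+ n * r) -> I r.
  by elim: n r => [|n IH] r; [rewrite mul1r|rewrite exprS -mulrA => /xnzd/IH].
have [|||P' [P'P IP' P'S]] := @avoiding_prime I
    [set r | exists n s, ~ P s /\ r = x ^+ n * s] II.
- by exists 0%N, 1; rewrite mulr1.
- move=> _ _ [n [s [Ps ->]]] [k [t [Pt ->]]]; exists (n + k)%N, (s * t).
  by split; [move=> /PM[]|rewrite exprD mulrACA].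
- by move=> a Ia [n [s [Ps aE]]]; rewrite aE in Ia; exact/Ps/IP/(xnzdX n).
exists P'; split=> //; split.
  move=> r P'r; apply: contrapT => nPr; apply: (P'S r P'r).
  by exists 0%N, r; rewrite mul1r.
move=> /(_ _ Px)/P'S; apply; exists 1%N, 1; split=> //.
by rewrite mulr1.
Qed.

Lemma maximal_above I : is_ideal I -> ~ I 1 ->
  exists2 J, is_maximal J & I `<=` J.
Proof.
move=> II I1; have [|//|J [[JI J1] IJ Jmax]] :=
  @noetherian_maximal (fun J => is_ideal J /\ ~ J 1) I; first by move=> ? [].
exists J => //; split=> // K KI K1 JK; apply/seteqP; split=> //.
exact: Jmax.
Qed.

Variables (m : set R) (localR : is_local m).

Lemma local_ideal : is_ideal m.
Proof. by case: localR.1. Qed.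

Lemma proper_le_local I : is_ideal I -> ~ I 1 -> I `<=` m.
Proof. by move=> II /(maximal_above II)[J /(localR.2 _) ->]. Qed.

Lemma local_inv r : ~ m r -> exists v, v * r = 1.
Proof.
move=> mr; apply: contrapT => nv; apply: mr.
have zI := @zero_is_submodule R R^o.
apply: (proper_le_local (add_gen_ideal r zI)); last exact: add_gen_mem.
by move=> [a [b [/= -> ar]]]; apply: nv; exists a; rewrite [RHS]ar addr0.
Qed.

Lemma local_prime : is_prime m.
Proof.
have mI := local_ideal; have [_ m1 _] := localR.1.
split=> // a b mab; apply: contrapT => /not_orP[/local_inv[v va] nb].
by apply: nb; rewrite -[b]mul1r -va -mulrA; exact: idealM.
Qed.

Lemma local_one_sub r : m r -> exists v, v * (1 - r) = 1.
Proof.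
move=> mr; apply: local_inv => m1r; have [_] := localR.1; case.
by rewrite -(subrK r 1); apply: idealD => //; exact: local_ideal.
Qed.

(** Let [K] be maximal among the ideals that contain [I] but not [J]. For [x] in [m] and [y] in [J],
    if [x * y] were outside [K], then K + (xy) would contain [y], and a unit [1 - a * x] would put
    [y] in [K]. So [K] contains mJ + I, hence [J]. *)
Lemma nakayama I J : is_ideal I -> is_ideal J ->
  (forall r, J r -> exists x y i, [/\ m x, J y, I i & r = x * y + i]) -> J `<=` I.
Proof.
move=> II JI Jm; apply: contrapT => nJI.
have [|//|K [[KI nJK] IK Kmax]] := @noetherian_maximal
  (fun K => is_ideal K /\ ~ (J `<=` K)) I; first by move=> ? [].
have mJK x y : m x -> J y -> K (x * y).
  move=> mx Jy; have [Ky|nKy] := pselect (K y); first exact: idealM.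
  apply: (Kmax (add_gen K (x * y))); last exact: add_gen_mem.
    split=> [|/(_ _ Jy)[a [b [Kb yE]]]]; first exact: add_gen_ideal.
    have [v v1] := local_one_sub (idealM a local_ideal mx); apply: nKy.
    rewrite -[y]mul1r -v1 -mulrA; apply: idealM => //.
    by rewrite mulrBl mul1r {1}yE mulrA addrAC subrr add0r.
  exact: add_gen_sub.
apply: nJK => r /Jm[x [y [i [mx Jy Ii ->]]]].
by apply: idealD => //; [exact: mJK|exact: IK].
Qed.

(** An ideal over [I] that is maximal among those containing no power of [m] is prime, hence equal
    to [m], which is absurd. *)
Lemma local_pow_sub I : is_ideal I -> (forall P, is_prime P -> I `<=` P -> P = m) ->
  exists n, ideal_pow m n `<=` I.
Proof.
move=> II IP; apply: contrapT => nI.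
have [|//|J [[JI Jn] IJ Jmax]] := @noetherian_maximal
  (fun J => is_ideal J /\ ~ exists n, ideal_pow m n `<=` J) I; first by move=> ? [].
have J1 : ~ J 1 by move=> J1; apply: Jn; exists 0%N => x _; exact: ideal1.
have Jprime : is_prime J.
  split=> // a b Jab; apply: contrapT => /not_orP[nJa nJb].
  have pow x : ~ J x -> exists n, ideal_pow m n `<=` add_gen J x.
    move=> nJx; apply: contrapT => nn; apply/nJx/(Jmax (add_gen J x)).
    - by split=> //; exact: add_gen_ideal.
    - exact: add_gen_sub.
    - exact: add_gen_mem.
  have [i mi] := pow _ nJa; have [j mj] := pow _ nJb.
  apply: Jn; exists (i + j)%N; apply: ideal_pow_add => // x y.
  move=> /mi[u [p [Jp ->]]] /mj[v [q [Jq ->]]].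
  rewrite (_ : _ * _ = (u * v) * (a * b) + ((v * b + q) * p + (u * a) * q));
  last by ring.
  by do ?[apply: idealD => //]; exact: idealM.
apply: Jn; exists 1%N; rewrite (IP _ Jprime IJ) => r; apply; split.
  exact: local_ideal.
by move=> _ [a ma [b _ <-]]; rewrite mulrC; apply: idealM => //; exact: local_ideal.
Qed.

End Noetherian.

(** * Regular sequences: permutations, powers, colon ideals and the primes above them *)

Section Regular.
Variables (R : comNzRingType) (m : set R).
Hypotheses (noethR : noetherian R) (localR : is_local m).
Implicit Types (s t : seq R).

(* The regular sequence is listed from its last element to its first one. *)
Fixpoint reg s : Prop :=
  if s is x :: t then
    [/\ m x, reg t & forall r, igen t (x * r) -> igen t r] else True.

Lemma perm_cat_cons (T : eqType) (x : T) (s t : seq T) :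
  perm_eq (x :: s ++ t) (s ++ x :: t).
Proof. by rewrite (perm_catCA [:: x] s t). Qed.

(** The shift keeps every exponent positive, so that the powers stay in [m]. *)
Definition pw n s := [seq x ^+ n.+1 | x <- s].

Lemma igen_eq s t : s =i t -> igen s = igen t.
Proof. by move=> st; apply/seteqP; split; apply: igen_sub => x; rewrite st. Qed.

(** Nakayama shows that [y] is regular modulo [s]: if [y * r] is in (s), then [r = a * x + b] with
    [b] in (s), and cancelling [x] puts [a] in the colon ideal ((s) : y) again. *)
Lemma reg_swap x y s : reg [:: y, x & s] -> reg [:: x, y & s].
Proof.
move=> [my [mx sreg xreg] yreg].
have sI := igen_ideal s.
have yreg' r : igen s (y * r) -> igen s r.
  apply: (nakayama noethR localR sI (colon_ideal y sI)) => {}r /= yr.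
  have /igen_cons[a [b [sb rE]]] := yreg _ (@igen_consW _ x _ _ yr).
  exists x, a, b; split=> //; last by rewrite mulrC.
  apply: xreg; rewrite (_ : x * _ = y * r + (- y) * b); last by rewrite rE; ring.
  by apply: (idealD sI) => //; exact: (idealM _ sI).
(* As [y * a] is in (x) + (s), [a = c * x + e] with [e] in (s), and [x] cancels from
   [x * (r - c * y) = e * y + b]. *)
split=> //= r /igen_cons[a [b [sb xr]]].
have /yreg/igen_cons[c [e [se aE]]] : igen (x :: s) (y * a).
  apply/igen_cons; exists r, (- b); split; last by rewrite [r * x]mulrC xr; ring.
  by rewrite -mulN1r; exact: (idealM _ sI).
apply/igen_cons; exists c, (r - c * y); split; last by ring.
apply: xreg; rewrite (_ : _ * _ = e * y + b); last by rewrite mulrBr xr aE; ring.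
by apply: (idealD sI) => //; rewrite mulrC; exact: (idealM _ sI).
Qed.

Lemma reg_front s x t : reg (s ++ x :: t) -> reg (x :: s ++ t).
Proof.
elim: s => [//|y s IH] /= [my /IH xst yreg]; apply: reg_swap; split=> // r.
rewrite (@igen_eq _ (s ++ x :: t)); first exact: yreg.
by move=> z; rewrite !(inE, mem_cat) orbCA.
Qed.

Lemma reg_perm s t : perm_eq s t -> reg s -> reg t.
Proof.
elim: t s => [//|x t IH] s st sreg.
have xs : x \in s by rewrite (perm_mem st) mem_head.
case/splitPr: xs st sreg => s1 s2 st /reg_front[mx s12reg xreg].
have {}st : perm_eq (s1 ++ s2) t.
  by rewrite -(perm_cons x) -(permPr st) -cat1s perm_catCA.
split=> //; first exact: IH st s12reg.
by rewrite -(igen_eq (perm_mem st)).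
Qed.

Lemma reg_pow_head n x s : reg (x :: s) -> reg (x ^+ n.+1 :: s).
Proof.
move=> [mx sreg xreg]; split=> //; first exact: ideal_exp (local_ideal localR) mx.
elim: n.+1 => [|k IH] r; first by rewrite mul1r.
by rewrite exprS -mulrA => /xreg/IH.
Qed.

(** Each element is raised to its power at the head and then permuted into the tail [t], which the
    induction leaves alone. *)
Lemma reg_pow n s t : reg (s ++ t) -> reg (pw n s ++ t).
Proof.
elim: s t => [//|x s IH] t /(@reg_pow_head n) xst.
apply: (@reg_perm (pw n s ++ x ^+ n.+1 :: t)).
  by rewrite perm_sym perm_cat_cons.
by apply: IH; apply: reg_perm xst; exact: perm_cat_cons.
Qed.

Lemma reg_pow_all n s : reg s -> reg (pw n s).
Proof. by rewrite -[pw n s]cats0 -{1}[s]cats0; exact: reg_pow. Qed.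

Lemma reg_pow_nzd n k x s t : reg (x :: s ++ t) ->
  forall r, igen (pw n s ++ t) (x ^+ k * r) -> igen (pw n s ++ t) r.
Proof.
move=> xst.
have [_ _ xreg] : reg (x :: pw n s ++ t).
  apply: (@reg_perm (pw n s ++ x :: t)); first by rewrite perm_sym perm_cat_cons.
  by apply: reg_pow; apply: reg_perm xst; exact: perm_cat_cons.
elim: k => [|k IH] r; first by rewrite mul1r.
by rewrite exprS -mulrA => /xreg/IH.
Qed.

Lemma reg_pow_tail n x s t : reg (x :: s ++ t) -> reg (s ++ x ^+ n.+1 :: t).
Proof.
move=> /(@reg_pow_head n); apply: reg_perm.
exact: perm_cat_cons.
Qed.

Lemma igen_cat_cons s x t r : igen (s ++ x :: t) r <-> igen (x :: s ++ t) r.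
Proof.
rewrite (@igen_eq (s ++ x :: t) (x :: s ++ t)) // => z.
by rewrite !(inE, mem_cat) orbCA.
Qed.

(** Cancelling [x ^+ k] for the head [x] puts the remaining product in the ideal where [x ^+ n.+1]
    replaces [x ^+ (n + k).+1]; the tail [t] absorbs this power for the induction. *)
Lemma colon_prod n k s t r : reg (s ++ t) ->
  igen (pw (n + k) s ++ t) (r * \prod_(x <- s) x ^+ k) -> igen (pw n s ++ t) r.
Proof.
elim: s t r => [|x s IH] t r; first by rewrite big_nil mulr1.
move=> xst; rewrite big_cons => /igen_cons[b [q [Qq rE]]].
have nzd := @reg_pow_nzd (n + k) k _ _ _ xst.
apply/igen_cat_cons; apply: IH; first exact: reg_pow_tail.
apply/igen_cat_cons/igen_cons.
exists b, (r * \prod_(y <- s) y ^+ k - b * x ^+ n.+1); split; last by ring.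
apply: nzd; rewrite (_ : _ * _ = q) //; apply: (addrI (b * x ^+ (n + k).+1)).
by rewrite -rE -addSn exprD; ring.
Qed.

(** Cancelling [x ^+ n.+1] in the condition for the head gives [r = a * x ^+ k + q]. Cancelling
    [x ^+ k] in the other conditions passes them on to [a], with [x ^+ n.+1] added to the tail. *)
Lemma colon_gens n k s t r : reg (s ++ t) ->
  (forall x, x \in s -> igen (pw (n + k) s ++ t) (x ^+ n.+1 * r)) ->
  exists a b, igen (pw (n + k) s ++ t) b /\ r = a * \prod_(x <- s) x ^+ k + b.
Proof.
elim: s t r => [|x s IH] t r xst rs.
  by exists r, 0; split; [exact: (ideal0 (igen_ideal _))|rewrite big_nil; ring].
have nzd j := @reg_pow_nzd (n + k) j _ _ _ xst.
have QI := igen_ideal (pw (n + k) s ++ t).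
have /igen_cons[a [q [Qq rE]]] := rs x (mem_head _ _).
set Q := igen (pw (n + k) s ++ t) in nzd QI Qq.
have {q Qq rE} [q Qq rE] : exists2 q, Q q & r = a * x ^+ k + q.
  exists (r - a * x ^+ k); last by ring.
  apply: (nzd n.+1); rewrite (_ : _ * _ = q) //.
  by apply: (addrI (a * x ^+ (n + k).+1)); rewrite -rE -addSn exprD; ring.
have [||a' [b' [/igen_cat_cons/igen_cons[c [e [Qe ->]]] aE]]] :=
  IH (x ^+ n.+1 :: t) a; first exact: reg_pow_tail.
  move=> y ys.
  have /igen_cons[c [e [Qe yE]]] :
      igen (pw (n + k) (x :: s) ++ t) (y ^+ n.+1 * r).
    by apply: rs; rewrite inE ys orbT.
  apply/igen_cat_cons/igen_cons; exists c, (y ^+ n.+1 * a - c * x ^+ n.+1).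
  split; last by ring.
  apply: (nzd k); rewrite (_ : _ * _ = e + (- y ^+ n.+1) * q); last first.
    apply: (addrI (c * x ^+ (n + k).+1)); rewrite [RHS]addrA -yE rE -addSn exprD; ring.
  by apply: (idealD QI) => //; exact: (idealM _ QI).
exists a', (c * x ^+ (n + k).+1 + (x ^+ k * e + q)); split.
  apply/igen_cons; exists c, (x ^+ k * e + q); split=> //.
  by apply: (idealD QI) => //; exact: (idealM _ QI).
by rewrite rE aE big_cons -addSn exprD; ring.
Qed.

(** Each element is regular modulo the tail of the list after it, so [smaller_prime] steps down once
    per element. *)
Lemma prime_chain_below s P : reg s -> is_prime P -> igen s `<=` P ->
  exists c : nat -> set R, [/\ forall i, (i <= size s)%N -> is_prime (c i),
    forall i, (i < size s)%N -> c i `<` c i.+1 & c (size s) = P].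
Proof.
elim: s P => [|x t IH] P; first by exists (fun=> P).
move=> [mx treg xreg] Pprime xtP.
have tP : igen t `<=` P by move=> r tr; apply: xtP; exact: igen_consW.
have Px : P x by apply: xtP; apply: igen_mem; exact: mem_head.
have [Q [Qprime tQ QP]] :=
  smaller_prime noethR (igen_ideal t) Pprime tP Px xreg.
have [c [cprime clt cQ]] := IH Q treg Qprime tQ.
exists (fun i => if (i <= size t)%N then c i else P); split=> [i|i|] /=.
- by case: ifP => // ? _; exact: cprime.
- rewrite ltnS {1}leq_eqVlt => /predU1P[->|it]; last first.
    by rewrite it (ltnW it); exact: clt.
  by rewrite leqnn ltnn cQ.
- by rewrite ltnn.
Qed.

(** Otherwise [m] on top of the chain ending at [P] gives a chain longer than the dimension. *)
Lemma prime_above_param s P : krull_dim R (size s) -> reg s ->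
  is_prime P -> igen s `<=` P -> P = m.
Proof.
move=> [_ dimR] sreg Pprime sP.
have [PI P1 _] := Pprime.
have Pm : P `<=` m by exact: (proper_le_local noethR localR PI P1).
apply: contrapT => Pnm.
have [c [cprime clt cP]] := prime_chain_below sreg Pprime sP.
suff /dimR : has_prime_chain R (size s).+1 by rewrite ltnn.
exists (fun i => if (i <= size s)%N then c i else m); split=> i.
  by case: ifP => [is_ _|_ _]; [exact: cprime|exact: (local_prime noethR localR)].
rewrite ltnS {1}leq_eqVlt => /predU1P[->|is_]; last first.
  by rewrite is_ (ltnW is_); exact: clt.
rewrite leqnn ltnn cP; split=> // mP; apply: Pnm.
by apply/seteqP.
Qed.

Lemma pow_sub_param n s : krull_dim R (size s) -> reg s ->
  exists k, ideal_pow m k `<=` igen (pw n s).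
Proof.
move=> dimR sreg; apply: (local_pow_sub noethR localR (igen_ideal _)) => P Pprime sP.
by apply: prime_above_param Pprime sP; [rewrite size_map|exact: reg_pow_all].
Qed.

Lemma regular_sequence_reg s : {in s, forall x, m x} -> regular_sequence s ->
  reg (rev s).
Proof.
move=> sm [sreg _]; 
suff h i : (i <= size s)%N -> reg (rev (take i s)).
  by have := h _ (leqnn _); rewrite take_size.
elim: i => [|i IH] is_; first by rewrite take0.
rewrite (take_nth 0) // rev_rcons; split.
- by apply: sm; exact: mem_nth.
- exact/IH/ltnW.
- move=> r; rewrite (@igen_eq _ (take i s)); first exact: sreg.
  by move=> z; rewrite mem_rev.
Qed.

End Regular.

Lemma cohen_macaulay_params (R : comNzRingType) (m : set R) d :
  krull_dim R d -> cohen_macaulay m -> exists2 s, reg m s & size s = d.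
Proof.
move=> [chd maxd] [n [[chn maxn] [[s [sm sreg sn]] _]]].
exists (rev s); first exact: regular_sequence_reg.
by rewrite size_rev sn; apply/eqP; rewrite eqn_leq maxd// maxn.
Qed.

(** * Elements killed by a sequence *)

Section Killed.
Variable R : comNzRingType.
Implicit Types (s : seq R) (M N E : lmodType R).

(** These elements form Hom(R/J, M), where [s] generates J. *)
Definition killed s M (y : M) : Prop := forall x, x \in s -> x *: y = 0.

Lemma killed_cons x s M (y : M) : killed (x :: s) y <-> x *: y = 0 /\ killed s y.
Proof.
split=> [xsy|[xy sy] z]; last by rewrite inE => /predU1P[->|/sy].
by split=> [|z zs]; apply: xsy; rewrite inE ?eqxx// zs orbT.
Qed.

Lemma killed_lin s M a (y z : M) : killed s y -> killed s z -> killed s (a *: y + z).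
Proof.
move=> sy sz x xs.
by rewrite scalerDr scalerA mulrC -scalerA sy// sz// scaler0 addr0.
Qed.

Lemma killed0 s M : killed s (0 : M).
Proof. by move=> x _; rewrite scaler0. Qed.

Lemma killedZ s M a (y : M) : killed s y -> killed s (a *: y).
Proof. by move=> sy; rewrite -[_ *: _]addr0; exact: killed_lin (@killed0 s M). Qed.

Lemma killedB s M (y z : M) : killed s y -> killed s z -> killed s (y - z).
Proof. by move=> sy sz; rewrite addrC -scaleN1r; exact: killed_lin. Qed.

Lemma killed_map s M N (f : {linear M -> N}) y : killed s y -> killed s (f y).
Proof. by move=> sy x xs; rewrite -linearZ_LR sy// linear0. Qed.

Lemma killed_igen s M (y : M) r : killed s y -> igen s r -> r *: y = 0.
Proof.
move=> sy; apply: (@igen_le _ s [set r | r *: y = 0]) => //.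
split=> [|a b /= ay by_|a b /= bY]; first exact: scale0r.
  by rewrite scalerDl ay by_ addr0.
by rewrite -[_ *: b]/(a * b) -scalerA bY scaler0.
Qed.

(* Extend [r |-> r w] along the injection of [R/J] into [R/J] given by the
   multiplication by [x], where [J] is the ideal generated by [s]. *)
Lemma killed_divisible s E x (w : E) : injective_module E ->
  (forall r, igen s (x * r) -> igen s r) -> killed s w ->
  exists2 v, killed s v & x *: v = w.
Proof.
move=> injE xnzd sw.
pose J : submodule R^o := Submodule (igen_ideal s).
have u_lin : linear (fun r : R^o => x *: quot_proj J r).
  by move=> a p q; rewrite linearP scalerDr !scalerA mulrC.
have f_lin : linear (fun r : R^o => r *: w : E).
  by move=> a p q; rewrite scalerDl -scalerA.
have [|g gE] := @extend_along _ _ _ _ (mk_linear u_lin) (mk_linear f_lin) injE.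
  move=> r /=; rewrite -linearZ_LR -[0](linear0 (quot_proj J)) => /quot_projP.
  by rewrite subr0 => /xnzd /(killed_igen sw).
exists (g (quot_proj J 1)) => [y ys|].
  rewrite -linearZ_LR; suff -> : y *: quot_proj J 1 = 0 by rewrite linear0.
  rewrite -linearZ_LR -[RHS](linear0 (quot_proj J)).
  apply/quot_projP; rewrite subr0.
  by rewrite -[_ *: _]/(y * 1) mulr1; exact: igen_mem.
by have := gE 1; rewrite /= linearZ_LR scale1r.
Qed.

End Killed.

(** * Dimension shifting along a regular sequence *)

Section Bounded.
Variables (R : comNzRingType) (M : lmodType R) (I : injective_resolution M).
Variable A : forall k, set (I k).

(** These are the coboundaries of a subcomplex [A]: elements killed by a sequence for Ext, torsion
    elements for local cohomology. *)
Definition bounded k : I k -> Prop :=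
  if k is k'.+1 then fun z => exists2 y : I k', A y & ires_d I k' y = z
  else fun z => z = 0.

End Bounded.

Lemma bounded_sub (R : comNzRingType) (M : lmodType R)
    (I : injective_resolution M) (A B : forall k, set (I k)) k (z : I k) :
  (forall j (y : I j), A j y -> B j y) -> bounded A z -> bounded B z.
Proof. by case: k z => [//|k] z AB [y /AB By yz]; exists y. Qed.

Section Stairs.
Variables (R : comNzRingType) (m : set R).

Section Resolution.
Variables (M : lmodType R) (I : injective_resolution M).
Implicit Types (s : seq R).

(** Ext(R/J, M) vanishes in degrees above the length of [s]. If z = dy with [y] killed by the tail,
    then xy is a cocycle dw; writing w = xv, the element y - dv is killed by [x] too. *)
Lemma killed_exact s k (z : I k.+1) : reg m s -> (size s <= k)%N ->
  killed s z -> ires_d I k.+1 z = 0 -> exists2 y, killed s y & ires_d I k y = z.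
Proof.
elim: s k z => [|x s IH] k z; first by move=> _ _ _ /ires_exactS[y]; exists y.
move=> [mx sreg xnzd]; case: k z => [//|k] z sk /killed_cons[xz sz] dz.
have [y sy yz] := IH _ _ sreg (ltnW sk) sz dz.
have dxy : ires_d I k.+1 (x *: y) = 0 by rewrite linearZ_LR yz.
have [w sw wy] := IH _ _ sreg sk (killedZ x sy) dxy.
have [v sv vw] := killed_divisible (@ires_injective _ _ I k) xnzd sw.
exists (y - ires_d I k v).
  apply/killed_cons; split; last by apply: killedB => //; exact: killed_map.
  by rewrite scalerBr -linearZ_LR vw wy subrr.
rewrite linearB yz (_ : ires_d I _ (ires_d I _ _) = 0) ?subr0//.
by apply/ires_exactS; exists v.
Qed.

(* [stair n s z u] relates a cocycle [z] to [u] under the isomorphism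
   Ext^k(R/J, M) = M/JM, where [J] is generated by the powers [x ^+ n.+1] of the
   elements of the regular sequence [s], of length [k], and where Ext^k is
   computed as the cohomology of Hom(R/J, I). *)
Fixpoint stair n s : I (size s) -> M -> Prop :=
  if s is x :: t then fun z u =>
    exists y, [/\ killed (pw n t) y, stair n (x ^+ n.+1 *: y) u &
                  ires_d I (size t) y = z]
  else fun z u => z = ires_aug I u.

Lemma stair_lin n s a z u z' u' : stair n z u -> stair n z' u' ->
  @stair n s (a *: z + z') (a *: u + u').
Proof.
elim: s z u z' u' => [|x s IH] z u z' u' /=; first by move=> -> ->; rewrite linearP.
move=> [y [sy yu <-]] [y' [sy' yu' <-]]; exists (a *: y + y').
rewrite linearP; split=> //; first exact: killed_lin.
by rewrite scalerDr scalerA mulrC -scalerA; exact: IH.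
Qed.

Lemma stair0 n s : @stair n s 0 0.
Proof.
elim: s => [|x s IH] /=; first by rewrite linear0.
by exists 0; rewrite scaler0 linear0; split=> //; exact: killed0.
Qed.

Lemma stairZ n s a z u : stair n z u -> @stair n s (a *: z) (a *: u).
Proof.
move=> zu; rewrite -[X in stair _ X]addr0 -[X in stair _ _ X]addr0.
exact: stair_lin (stair0 n s).
Qed.

Lemma stairB n s z u z' u' : stair n z u -> stair n z' u' ->
  @stair n s (z - z') (u - u').
Proof.
move=> zu zu'; rewrite addrC -scaleN1r [u - _]addrC -scaleN1r; exact: stair_lin.
Qed.

Lemma stair_cocycle n s z u : @stair n s z u ->
  ires_d I (size s) z = 0 /\ killed (pw n s) z.
Proof.
elim: s z u => [|x s IH] z u /=.
  by move=> ->; split=> //; apply/ires_exact0; exists u.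
move=> [y [sy /IH[dxy _] <-]]; split; first by apply/ires_exactS; exists y.
apply/killed_cons; split; last exact: killed_map.
by rewrite -linearZ_LR.
Qed.

Lemma stair_exists n s u : reg m (pw n s) -> exists z, @stair n s z u.
Proof.
elim: s => [|x s IH] /=; first by exists (ires_aug I u).
move=> [mx sreg xnzd]; have [z zu] := IH sreg; have [dz sz] := stair_cocycle zu.
have [y sy yz] := killed_divisible (@ires_injective _ _ I (size s)) xnzd sz.
by exists (ires_d I _ y), y; rewrite yz.
Qed.

(** This makes [M] surject onto Ext: as [x ^+ n.+1] kills z = dy, it multiplies [y] into a cocycle
    one degree lower. *)
Lemma cocycle_stair n s z : reg m (pw n s) -> ires_d I (size s) z = 0 ->
  killed (pw n s) z -> exists u, @stair n s z u.
Proof.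
elim: s z => [|x s IH] z /=; first by move=> _ /ires_exact0[u <-] _; exists u.
move=> [mx sreg xnzd] dz /killed_cons[xz sz].
have [y sy yz] := killed_exact sreg (eq_leq (size_map _ _)) sz dz.
have [||u yu] := IH (x ^+ n.+1 *: y) sreg; first by rewrite linearZ_LR yz.
  exact: killedZ.
by exists u, y.
Qed.

Lemma stair_bounded n s z : reg m (pw n s) -> @stair n s z 0 ->
  bounded (fun k => @killed R (pw n s) (I k)) z.
Proof.
elim: s z => [|x s IH] z; first by move=> _ /= ->; rewrite linear0.
move=> [mx sreg xnzd] [y [sy y0 <-]].
(* Then [y - v] is killed by the whole sequence and still maps to [z]. *)
suff [v [sv dv xyv]] : exists v, [/\ killed (pw n s) v, ires_d I _ v = 0 &
    x ^+ n.+1 *: v = x ^+ n.+1 *: y].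
  exists (y - v); last by rewrite linearB dv subr0.
  by apply/killed_cons; rewrite scalerBr xyv subrr; split=> //; exact: killedB.
move: (IH _ sreg y0) => {z IH sreg y0}.
case: s y sy xnzd => [|x' t] y sy xnzd /=.
  by move=> ->; exists 0; rewrite scaler0 linear0; split=> //; exact: killed0.
move=> [w sw wy].
have [v sv vw] := killed_divisible (@ires_injective _ _ I (size t)) xnzd sw.
exists (ires_d I _ v); rewrite -linearZ_LR vw wy; split=> //.
  exact: killed_map.
by apply/ires_exactS; exists v.
Qed.

(** [N] stands for JM. Two preimages [y] and [y'] of [z] differ by a cocycle with a stair to some
    [u']; as [x ^+ n.+1] kills [y'], subtraction leaves a stair from 0 to [u - x ^+ n.+1 *: u']. *)
Lemma bounded_stair n s z u (N : submodule M) : reg m (pw n s) ->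
  @stair n s z u -> bounded (fun k => @killed R (pw n s) (I k)) z ->
  (forall x v, x \in pw n s -> N (x *: v)) -> N u.
Proof.
have [N0 ND NZ] := submoduleP N.
elim: s z u => [|x s IH] z u.
  move=> _ /= -> au0 _; suff -> : u = 0 by [].
  by apply: (@ires_aug_inj _ _ I); rewrite au0 linear0.
move=> [mx sreg xnzd] [y [sy yu <-]] [y' /killed_cons[xy' sy'] dy'] JN.
have [|u' yu'] := @cocycle_stair n s (y - y') sreg _ (killedB sy sy').
  by rewrite linearB dy' subrr.
have {yu'} := stairB yu (stairZ (x ^+ n.+1) yu').
rewrite scalerBr xy' subr0 subrr => u0.
rewrite -(subrK (x ^+ n.+1 *: u') u); apply: ND; last by apply: JN; rewrite mem_head.
apply: IH sreg u0 _ _; last by move=> v w vs; apply: JN; rewrite inE vs orbT.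
case: (s) => [//|v t]; exists 0; last exact: linear0.
exact: killed0.
Qed.

(** The transition from level [n] to level [n + k] is thus multiplication by this product; the
    intermediate elements [y] are kept. *)
Lemma stair_pow n k s z u : stair n z u ->
  @stair (n + k) s z ((\prod_(x <- s) x ^+ k) *: u).
Proof.
elim: s z u => [|x s IH] z u /=; first by move=> ->; rewrite big_nil scale1r.
move=> [y [sy /IH yu <-]]; exists y; split=> //.
  move=> _ /mapP[v vs ->]; rewrite -addSn exprD mulrC -scalerA sy ?scaler0//.
  by apply/mapP; exists v.
rewrite big_cons -scalerA -addSn exprD mulrC -scalerA; exact: stairZ.
Qed.

End Resolution.

Lemma stair_map (M N : lmodType R) (I : injective_resolution M)
    (J : injective_resolution N) (f : {linear M -> N})
    (phi : forall k, {linear I k -> J k}) n s z u :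
  lifts f phi -> @stair M I n s z u -> @stair N J n s (phi (size s) z) (f u).
Proof.
move=> [phi0 phiS]; elim: s z u => [|x s IH] z u /=.
  by move=> ->; rewrite -[RHS]/((_ \o _) u) phi0.
move=> [y [sy yu <-]]; exists (phi (size s) y); split.
- exact: killed_map.
- by rewrite -linearZ_LR; exact: IH.
- exact: phiS.
Qed.

End Stairs.

(** * Cocycles representing local cohomology classes *)

Section Representatives.
Variables (R : comNzRingType) (m : set R) (k : nat).
Local Notation H := (local_cohomology m k).
Local Notation res := (@std_resolution R).

Definition torsion_elt (M : lmodType R) (y : M) : Prop := torsion_submodule m M y.

(** The cocycle lives in the resolution itself, which hides the torsion submodules and the quotient
    from later arguments. *)
Definition rep (M : lmodType R) (h : H M) (z : res M k) : Prop :=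
  exists (tz : torsion_submodule m (res M k) z)
    (dz : cocycles (torsion_functor m) res M k (submod_elt tz)),
    h = subq_proj (coboundaries (torsion_functor m) res M k) dz.

Lemma torsion_fmap_eq0 (M N : lmodType R) (f : {linear M -> N}) z
    (tz : torsion_submodule m M z) :
  fmap (torsion_functor m) f (submod_elt tz) = 0 <-> f z = 0.
Proof.
by split=> [/(congr1 val)|fz] //; apply/val_inj.
Qed.

Lemma rep_exists M (h : H M) : exists z, rep h z.
Proof.
have [x [dx ->]] := subq_proj_surj h.
have tx := submod_valP x; exists (val x), tx.
have xE : submod_elt tx = x by exact/val_inj.
have dx' : cocycles (torsion_functor m) res M k (submod_elt tx) by rewrite xE.
exists dx'; apply/subq_projP; rewrite xE subrr.
by have [] := submoduleP (coboundaries (torsion_functor m) res M k).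
Qed.

Lemma rep_cocycle M (h : H M) z : rep h z ->
  ires_d (res M) k z = 0 /\ torsion_elt z.
Proof. by move=> [tz [dz _]]; split=> //; exact/(torsion_fmap_eq0 _ tz). Qed.

Lemma cocycle_rep M (z : res M k) : torsion_elt z -> ires_d (res M) k z = 0 ->
  exists h : H M, rep h z.
Proof.
move=> tz /(torsion_fmap_eq0 _ tz) dz0.
have dz : cocycles (torsion_functor m) res M k (submod_elt tz) := dz0.
by exists (subq_proj (coboundaries (torsion_functor m) res M k) dz), tz, dz.
Qed.

Lemma rep_eq M (h h' : H M) z z' : rep h z -> rep h' z' ->
  h = h' <-> bounded (fun j => @torsion_elt (res M j)) (z - z').
Proof.
move=> [tz [dz ->]] [tz' [dz' ->]].
apply: (iff_trans (subq_projP _ _ _)).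
case: k z z' tz tz' {dz dz'} => [|j] z z' tz tz' /=.
  split=> [/(congr1 val)//|zz']; exact/val_inj.
split=> [[y _ /(congr1 val) yz]|[y ty yz]].
  by exists (val y) => //; exact: submod_valP.
by exists (submod_elt ty) => //; exact/val_inj.
Qed.

Lemma repZ M a (h : H M) z : rep h z -> rep (a *: h) (a *: z).
Proof.
move=> [tz [dz ->]].
have [_ _ tZ] := submoduleP (torsion_submodule m (res M k)).
exists (tZ a _ tz).
have aE : submod_elt (tZ a _ tz) = a *: submod_elt tz by exact/val_inj.
have daz : cocycles (torsion_functor m) res M k (submod_elt (tZ a _ tz)).
  rewrite aE; have [_ _] := submoduleP (cocycles (torsion_functor m) res M k).
  exact.
exists daz; rewrite /subq_proj -linearZ_LR; congr quot_proj; exact/val_inj/val_inj.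
Qed.

Lemma rep_map (M N : lmodType R) (f : {linear M -> N}) phi (h : H M) z :
  lifts (I := res M) (J := res N) f phi -> rep h z ->
  rep (fmap H f h) (phi k z).
Proof.
move=> fphi [tz [dz ->]]; exists (torsion_map (phi k) tz).
have phiE : submod_elt (torsion_map (phi k) tz) =
    fmap (torsion_functor m) (phi k) (submod_elt tz) by exact/val_inj.
have dphi : cocycles (torsion_functor m) res N k (submod_elt (torsion_map (phi k) tz)).
  by rewrite phiE; exact: (cocycles_map fphi.2).
exists dphi.
apply: etrans (derived_mapE (@torsion_functor_additive R m) fphi dz) _.
apply/subq_projP; rewrite phiE subrr.
by have [] := submoduleP (coboundaries (torsion_functor m) res N k).
Qed.

End Representatives.

(** * Top local cohomology as a union of Ext modules *)

Section TopCohomology.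
Variables (R : comNzRingType) (m : set R) (s : seq R).
Hypotheses (noethR : noetherian R) (localR : is_local m).
Hypotheses (dimR : krull_dim R (size s)) (sreg : reg m s).
Local Notation H := (local_cohomology m (size s)).
Local Notation res := (@std_resolution R).

Lemma sreg_pow n : reg m (pw n s).
Proof. exact: reg_pow_all. Qed.

Lemma killed_pow_le n k (M : lmodType R) (y : M) :
  killed (pw n s) y -> killed (pw (n + k) s) y.
Proof.
move=> sy _ /mapP[x xs ->]; rewrite -addSn exprD mulrC -scalerA sy ?scaler0//.
by apply/mapP; exists x.
Qed.

Lemma reg_in x : x \in s -> m x.
Proof.
elim: s sreg => [//|y t IH] /= [my /IH tm _].
by rewrite inE => /predU1P[->|/tm].
Qed.

(** [s] lies in [m], and conversely the ideal of the powers of [s] contains a power of [m]. *)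
Lemma torsion_killed (M : lmodType R) (y : M) :
  torsion_elt m y <-> exists n, killed (pw n s) y.
Proof.
split=> [[n ny]|[n sy]].
  exists n => _ /mapP[x xs ->]; apply: ny; apply: (ideal_pow_decr (leqnSn n)).
  exact/ideal_pow_exp/reg_in.
have [k mk] := pow_sub_param noethR localR n dimR sreg.
by exists k => a /mk; exact: killed_igen.
Qed.

Lemma torsion_bounded (M : lmodType R) k (z : res M k) :
  bounded (fun j => @torsion_elt R m (res M j)) z <->
  exists n, bounded (fun j => @killed R (pw n s) (res M j)) z.
Proof.
split=> [|[n]]; last by apply: bounded_sub => j y sy; apply/torsion_killed; exists n.
case: k z => [|k] z; first by exists 0%N.
by move=> [y /torsion_killed[n sy] yz]; exists n, y.
Qed.

Lemma stair_rep (M : lmodType R) n (z : res M (size s)) u : stair n z u ->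
  exists h : H M, rep h z.
Proof.
move=> /stair_cocycle[dz sz]; apply: cocycle_rep => //.
by apply/torsion_killed; exists n.
Qed.

Lemma stair_rep_eq (M : lmodType R) n (h h' : H M) z z' u :
  rep h z -> rep h' z' -> stair n z u -> stair n z' u -> h = h'.
Proof.
move=> hz hz' zu zu'; apply/(rep_eq hz hz')/torsion_bounded; exists n.
apply: (stair_bounded (sreg_pow n)); rewrite -(subrr u); exact: stairB.
Qed.

(** All levels from [n] on are offered, so that classes can be compared at a common level. *)
Lemma rep_stair (M : lmodType R) (h : H M) z : rep h z ->
  exists n, forall k, exists u, stair (n + k) z u.
Proof.
move=> /rep_cocycle[dz /torsion_killed[n sz]]; exists n => k.
by apply: (cocycle_stair (sreg_pow _) dz); exact: killed_pow_le.
Qed.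

(** A class given by [u] at level [n] is the image of the class of 1 under the map sending r to
    ru. *)
Lemma image_of_ring (M : lmodType R) (h : H M) :
  exists (f : {linear R^o -> M}) (h' : H R^o), h = fmap H f h'.
Proof.
have [z hz] := rep_exists h; have [n /(_ 0%N)[u]] := rep_stair hz.
rewrite addn0 => zu.
have [w w1] := stair_exists (res R^o) 1 (sreg_pow n).
have [h' h'w] := stair_rep w1.
have f_lin : linear (fun r : R^o => r *: u).
  by move=> a p q; rewrite scalerDl -scalerA.
exists (mk_linear f_lin), h'.
have [phi fphi] := lift_exists (res R^o) (res M) (mk_linear f_lin).
apply: (stair_rep_eq hz (rep_map fphi h'w) zu).
by have := stair_map fphi w1; rewrite /= scale1r.
Qed.

(* [c n] is the image in [H R] of the class of [1] in R/(x_1^(n+1), ...). *)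
Lemma generators : exists c : nat -> H R^o,
  [/\ forall h, exists n, forall k, exists r, h = r *: c (n + k)%N,
    forall n k, c n = (\prod_(x <- s) x ^+ k) *: c (n + k)%N,
    forall n r, igen (pw n s) r -> r *: c n = 0 &
    forall n r, r *: c n = 0 -> igen (pw n s) r].
Proof.
have cex n : exists h : H R^o, exists2 z, rep h z & stair n z (1 : R^o).
  have [w w1] := stair_exists (res R^o) 1 (sreg_pow n).
  by have [h hw] := stair_rep w1; exists h, w.
have [c cP] := choice cex.
exists c; split.
- move=> h; have [z hz] := rep_exists h; have [n nP] := rep_stair hz.
  exists n => k; have [r zr] := nP k; exists r.
  have [w cw w1] := cP (n + k)%N.
  apply: (stair_rep_eq hz (repZ (r : R) cw) zr).
  by have := stairZ (r : R) w1; rewrite -[r *: 1]/(r * 1) mulr1.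
- move=> n k; have [z cz z1] := cP n; have [w cw w1] := cP (n + k)%N.
  apply: (stair_rep_eq cz (repZ _ cw) (stair_pow k z1)); exact: stairZ.
- move=> n r sr; have [z cz /stair_cocycle[_ sz]] := cP n.
  have rz : r *: z = 0 by exact: killed_igen sr.
  have := repZ r cz; rewrite rz => h0.
  have := repZ 0 cz; rewrite !scale0r => h0'.
  apply/(rep_eq h0 h0').
  rewrite subrr; case: (size s) => [//|k]; exists 0; last exact: linear0.
  by exists 0%N => a _; rewrite scaler0.
- move=> n r cr; have [z cz z1] := cP n.
  have h0 := repZ 0 cz; rewrite !scale0r in h0.
  have hr := repZ r cz; rewrite cr in hr.
  have /(rep_eq hr h0)/torsion_bounded[k] : 0 = 0 :> H R^o by [].
  rewrite subr0 => bz.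
  (* At the common level [n + k], the coboundary [r *: z] corresponds to [r] times the product of
     the [x ^+ k], which is therefore in the ideal; [colon_prod] removes the product. *)
  have zr := stair_pow k (stairZ r z1).
  have bz' : bounded (fun j => @killed R (pw (n + k) s) (res R^o j)) (r *: z).
    apply: bounded_sub bz => j y; rewrite addnC; exact: killed_pow_le.
  have := bounded_stair (N := Submodule (igen_ideal (pw (n + k) s)) : submodule R^o)
    (sreg_pow _) zr bz'.
  move=> /(_ _)/= h; rewrite -[pw n s]cats0; apply: (@colon_prod _ m noethR localR n k).
    by rewrite cats0.
  rewrite cats0 [r * _]mulrC; rewrite -[r]mulr1; apply: h => x v xs.
  by rewrite -[x *: v]/(x * v) mulrC; apply: (idealM _ (igen_ideal _)); exact: igen_mem.
Qed.

Lemma idempotent_trivial (e : {linear H R^o -> H R^o}) :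
  (forall h, e (e h) = e h) -> (forall h, e h = 0) \/ (forall h, e h = h).
Proof.
move=> ee; have [c [cgen cS c0 cann]] := generators.
(* Each [x ^+ n.+1 * r] annihilates [c (n + k)], so [colon_gens] makes [r] a multiple of the
   product, up to an annihilator of [c (n + k)]. *)
have ec n : exists a, e (c n) = a *: c n.
  have [k /(_ n)[r]] := cgen (e (c n)); rewrite addnC => ecr.
  have [||a [b [sb rE]]] := @colon_gens _ m noethR localR n k s [::] r.
  - by rewrite cats0.
  - move=> x xs; rewrite cats0; apply: cann.
    rewrite -scalerA -ecr -linearZ_LR c0 ?linear0//.
    by apply: igen_mem; apply/mapP; exists x.
  exists a; rewrite cats0 in sb.
  by rewrite ecr rE scalerDl (c0 _ b)// addr0 (cS n k) scalerA.
have e01 n : e (c n) = 0 \/ e (c n) = c n.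
  have [a aE] := ec n.
  have aa : a *: (a *: c n) = a *: c n.
    by have := ee (c n); rewrite aE linearZ_LR aE.
  have [ma|nma] := pselect (m a).
    have [v v1] := local_one_sub noethR localR ma.
    left; rewrite aE -[a *: _]scale1r -v1 -scalerA scalerBl scale1r aa.
    by rewrite subrr scaler0.
  have [v v1] := local_inv noethR localR nma.
  right; rewrite aE -[LHS]scale1r -v1 -[RHS]scale1r -v1 -!scalerA.
  by rewrite aa.
have [eid|] := pselect (forall n, e (c n) = c n).
  right=> h; have [n /(_ 0%N)[r ->]] := cgen h.
  by rewrite linearZ_LR eid.
(* As [c n] is a multiple of [c (n + k)], [e] fixes none of the latter, so it kills them all. *)
move=> /existsNP[n ne]; left=> h.
have [k /(_ n)[r ->]] := cgen h; rewrite linearZ_LR addnC.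
have [->|ek] := e01 (n + k)%N; first by rewrite scaler0.
by case: ne; rewrite (cS n k) linearZ_LR ek.
Qed.

End TopCohomology.

(** * Direct summands of a functor generated by its value at the ring *)

(** The projection onto [F] at [R] is idempotent, so [F] or [G] vanishes at [R]; by naturality and
    lifting of classes to [R], the same one vanishes everywhere. *)
Lemma summand_dichotomy (R : comNzRingType) (H F G : functor R)
    (eta : forall M : lmodType R, {linear H M -> functor_sum F G M}) :
  (forall (M N : lmodType R) (f : {linear M -> N}),
     eta N \o fmap H f =1 fmap (functor_sum F G) f \o eta M) ->
  (forall M : lmodType R, bijective (eta M)) ->
  (forall (M : lmodType R) (h : H M),
     exists (f : {linear R^o -> M}) (h' : H R^o), h = fmap H f h') ->
  (forall e : {linear H R^o -> H R^o}, (forall h, e (e h) = e h) ->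
     (forall h, e h = 0) \/ (forall h, e h = h)) ->
  zero_functor F \/ nat_iso F H.
Proof.
move=> etaN etaB gen idem.
pose inv M : F M * G M -> H M :=
  sval (cid (let: Bijective g etaK gK := etaB M in ex_intro _ g (conj etaK gK)
    : exists g, cancel (eta M) g /\ cancel g (eta M))).
have etaK M : cancel (eta M) (inv M) by rewrite /inv; case: cid => g [].
have invK M : cancel (inv M) (eta M) by rewrite /inv; case: cid => g [].
(* This inclusion of the summand becomes the isomorphism once [G] vanishes on the image of [eta]. *)
have zeta_lin M : linear (fun q : F M => inv M (q, 0)).
  move=> a p q; apply: (can_inj (etaK M)); rewrite linearP !invK.
  by congr pair; rewrite /= scaler0 addr0.
have e_lin : linear (fun h => inv R^o ((eta R^o h).1, 0)).
  by move=> a p q; rewrite linearP /= zeta_lin.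
have eta_map (M : lmodType R) (h : H M) : exists (f : {linear R^o -> M}) h',
    eta M h = (fmap F f (eta R^o h').1, fmap G f (eta R^o h').2).
  by have [f [h' ->]] := gen M h; exists f, h'; exact: etaN.
have [h|e0|e1] := idem (mk_linear e_lin); first by rewrite /= invK.
  left=> M q; have [f [h' qE]] := eta_map M (inv M (q, 0)).
  have [-> _] : (q, 0) = (fmap F f (eta R^o h').1, fmap G f (eta R^o h').2).
    by rewrite -qE invK.
  have /= /(congr1 (eta R^o)) := e0 h'; rewrite invK linear0 => -[->].
  exact: linear0.
right; have eta2 (M : lmodType R) (h : H M) : (eta M h).2 = 0.
  have [f [h' ->]] := eta_map M h.
  by have /= <- := e1 h'; rewrite invK linear0.
exists (fun M => mk_linear (zeta_lin M)); split=> [M N f q|M].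
  apply: (can_inj (etaK N)); rewrite /= invK -[RHS]/((eta N \o fmap H f) _) etaN.
  by rewrite /= invK; congr pair; rewrite /= linear0.
exists (fun h => (eta M h).1) => [q|h] /=; first by rewrite invK.
by rewrite -[RHS]etaK -(eta2 M h); case: (eta M h).
Qed.

Theorem proposition4p1 (R : comNzRingType) (m : set R) (d : nat) (F : functor R)
    (noethR : noetherian R) (localR : is_local m) (complR : adic_complete m)
    (dimR : krull_dim R d) (CMR : cohen_macaulay m)
    (addF : additive_functor F)
    (summandF : direct_summand F (local_cohomology m d))
    (sumF : preserves_direct_sums F) :
  zero_functor F \/ nat_iso F (local_cohomology m d).
Proof.
have [s sreg sd] := cohen_macaulay_params dimR CMR.
(* The degree becomes [size s] itself, the index at which [stair] is typed. *)
move: summandF => [G [eta [etaN etaB]]]; subst d.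
apply: (summand_dichotomy etaN etaB); first exact: (image_of_ring noethR localR).
exact: (idempotent_trivial noethR localR).
Qed.
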